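(* Let $M_t=M_t^H(a)=\sum_{k=1}^Na_kB_t^{H_k}$, $t\in[0,T]$, be an $\mathbb{R}^d$-valued generalized mixed fractional Brownian motion with $\min\{H_1,\dots,H_N\}>\frac14$. Then for any $p>\frac{1}{\min\{H_k\}}$ there exists a constant $C>0$ such that, for all $m\ge1$ and all partitions $\mathcal D$ of $[0,T]$, $$\sum_{[u,v]\in\mathcal D}|M_v^m-M_u^m|^p\le C\qquad\text{and}\qquad\sum_{[u,v]\in\mathcal D}|\mathbb{M}_{u,v}^{m,(2)}|^{p/2}\le C$$ almost surely.
   Context: Here $N\ge1$, $H\in(0,1)^N$, $a\in\mathbb{R}^N\setminus\{0\}$, and $B^{H_1},\dots,B^{H_N}$ are independent; each $B^{H_k}$ is an $\mathbb{R}^d$-valued fractional Brownian motion with independent components of Hurst parameter $H_k$. With $t_l^m=l2^{-m}T$, $l=0,\dots,2^m$, $M^m$ is the continuous path which agrees with $M$ at all $t_l^m$ and is affine on each $[t_{l-1}^m,t_l^m]$, and $\mathbb{M}^{m,(2)}_{s,t}=\int_s^t(M^m_u-M^m_s)\otimes dM^m_u$. *)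

(* Defs.v *)
From HB Require Import structures.
From mathcomp Require Import all_boot all_order all_algebra.
From mathcomp Require Import all_classical all_reals all_analysis.
From mathcomp Require Import ring lra.
Set Implicit Arguments.
Unset Strict Implicit.
Unset Printing Implicit Defensive.
Import Order.TTheory GRing.Theory Num.Theory.
Import numFieldNormedType.Exports.
Local Open Scope classical_set_scope.
Local Open Scope ring_scope.

Section probability.
Context {R : realType} {disp : measure_display} {Omega : measurableType disp}.
Variable P : probability Omega R.

(* Point masses count as Gaussian laws. They need a separate case because
   [normal_prob m 0] is a uniform law, not the Dirac measure at [m]. *)
Definition gaussian_law (Y : Omega -> R) : Prop :=
  exists m s : R, 0 <= s /\
    forall A : set R, measurable A ->
      P (Y @^-1` A) = if s == 0 then \d_m A else normal_prob m s A.

Definition gaussian_process (I : set R) (X : R -> {RV P >-> R}) : Prop :=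
  forall (n : nat) (t c : 'I_n -> R), (forall i, I (t i)) ->
    gaussian_law (fun w => \sum_i c i * X (t i) w).

(* Fractional Brownian motion over the time set [I], which is meant to consist
   of nonnegative times. *)
Definition is_fbm (I : set R) (H : R) (X : R -> {RV P >-> R}) : Prop :=
  [/\ gaussian_process I X,
      forall t, I t -> ('E_P[X t] = 0)%E &
      forall s t, I s -> I t ->
        covariance P (X s) (X t) =
          ((s `^ (2 * H) + t `^ (2 * H) - `|t - s| `^ (2 * H)) / 2)%:E].

(* The sigma-algebra on [Omega] generated by the maps [X k], [k] in [D]. *)
Definition generated_sigma (K : Type) (D : set K) (X : K -> {RV P >-> R}) :
    set (set Omega) :=
  <<s [set E | exists k, D k /\ exists A : set R,
         measurable A /\ E = X k @^-1` A] >>.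

Definition mutually_independent (J : finType) (F : J -> set (set Omega)) : Prop :=
  forall (S : {set J}) (E : J -> set Omega),
    (forall j, j \in S -> F j (E j)) ->
    P (\bigcap_(j in [set` S]) E j) = (\prod_(j in S) P (E j))%E.

Definition is_fbm_vec (d : nat) (I : set R) (H : R)
    (X : 'I_d -> R -> {RV P >-> R}) : Prop :=
  (forall i, is_fbm I H (X i)) /\
  mutually_independent (fun i => generated_sigma I (X i)).

(* Independence of vector-valued processes: each one generates a sigma-algebra
   through all of its components at all times in [I]. *)
Definition independent_processes (N d : nat) (I : set R)
    (B : 'I_N -> 'I_d -> R -> {RV P >-> R}) : Prop :=
  mutually_independent (fun k : 'I_N =>
    generated_sigma [set it : 'I_d * R | I it.2] (fun it => B k it.1 it.2)).

Definition mixed_process (N d : nat) (a : 'rV[R]_N)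
    (B : 'I_N -> 'I_d -> R -> {RV P >-> R}) (t : R) (w : Omega) : 'rV[R]_d :=
  \row_i \sum_(k < N) a 0 k * B k i t w.

End probability.

(* As all [H 0 k] are below 1, the seed 1 plays no role once [0 < N]. *)
Definition min_hurst {R : realType} (N : nat) (H : 'rV[R]_N) : R :=
  \big[Num.min/1]_(k < N) H 0 k.

Section paths.
Context {R : realType}.

(* Euclidean norm, on vectors and (as Frobenius norm) on the tensor square of
   R^d, identified with d x d matrices. The library's norm on matrices is the
   maximum norm. *)
Definition euclid_norm (m n : nat) (A : 'M[R]_(m, n)) : R :=
  Num.sqrt (\sum_i \sum_j A i j ^+ 2).

Definition dyadic_time (T : R) (m l : nat) : R := l%:R * 2 ^- m * T.

Definition dyadic_path (d : nat) (T : R) (m : nat) (x : R -> 'rV[R]_d) (t : R) :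
    'rV[R]_d :=
  let l := Num.truncn (t / T * 2 ^+ m) in
  let t0 := dyadic_time T m l in
  let t1 := dyadic_time T m l.+1 in
  x t0 + ((t - t0) / (t1 - t0)) *: (x t1 - x t0).

Lemma dyadic_path_affine (d : nat) (T : R) (m : nat) (x : R -> 'rV[R]_d)
    (l : nat) (th : R) : 0 < T -> 0 <= th <= 1 ->
  dyadic_path T m x
    ((1 - th) * dyadic_time T m l + th * dyadic_time T m l.+1) =
  (1 - th) *: x (dyadic_time T m l) + th *: x (dyadic_time T m l.+1).
Proof.
move=> T0 /andP[th0 th1].
have T_neq0 : T != 0 by rewrite gt_eqF.
have e0 : (2 ^+ m : R) != 0 by rewrite expf_neq0.
have dE k : dyadic_time T m k.+1 - dyadic_time T m k = 2 ^- m * T.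
  by rewrite /dyadic_time -natr1; ring.
have argE : ((1 - th) * dyadic_time T m l + th * dyadic_time T m l.+1)
    / T * 2 ^+ m = l%:R + th.
  by rewrite /dyadic_time -natr1; field; rewrite e0 T_neq0.
rewrite /dyadic_path argE.
have [th_lt1|] := ltP th 1.
  have -> : Num.truncn (l%:R + th) = l.
    by apply/truncn_def; rewrite lerDl th0 -natr1 ltrD2l.
  rewrite dE.
  have -> : ((1 - th) * dyadic_time T m l + th * dyadic_time T m l.+1 -
      dyadic_time T m l) / (2 ^- m * T) = th.
    by rewrite /dyadic_time -natr1; field; rewrite e0 T_neq0.
  by rewrite scalerBr scalerBl scale1r addrAC addrA.
move=> th_ge1; have -> : th = 1 by apply/le_anti; rewrite th1.
rewrite natr1 natrK subrr mul0r add0r mul1r subrr mul0r scale0r addr0.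
by rewrite scale0r add0r scale1r.
Qed.

(* A partition s = t_0 < ... < t_n = t is encoded, as in [itv_partition], by
   the sequence of t_1, ..., t_n. *)
Definition partition_sum (s : R) (D : seq R) (F : R -> R -> R) : R :=
  \sum_(0 <= i < size D) F (nth s (s :: D) i) (nth s (s :: D) i.+1).

Definition stieltjes_sum (f g : R -> R) (s : R) (D : seq R) (xi : nat -> R) : R :=
  \sum_(0 <= i < size D)
    f (xi i) * (g (nth s (s :: D) i.+1) - g (nth s (s :: D) i)).

(* Riemann-Stieltjes integral of [f] against [g], as the limit of tagged sums
   when the mesh tends to 0. *)
Definition is_stieltjes_integral (f g : R -> R) (s t v : R) : Prop :=
  forall e, 0 < e -> exists2 delta, 0 < delta &
    forall (D : seq R) (xi : nat -> R), itv_partition s t D ->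
      (forall i, (i < size D)%N ->
         nth s (s :: D) i <= xi i <= nth s (s :: D) i.+1 /\
         nth s (s :: D) i.+1 - nth s (s :: D) i < delta) ->
      `|stieltjes_sum f g s D xi - v| < e.

Definition stieltjes_integral (f g : R -> R) (s t : R) : R :=
  xget 0 [set v | is_stieltjes_integral f g s t v].

Definition iterated_integral2 (d : nat) (x : R -> 'rV[R]_d) (s t : R) : 'M[R]_d :=
  \matrix_(i, j)
    stieltjes_integral (fun u => x u 0 i - x s 0 i) (fun u => x u 0 j) s t.

End paths.

(* Main.v *)
Require Import Defs.
From HB Require Import structures.
From mathcomp Require Import all_boot all_order all_algebra.
From mathcomp Require Import all_classical all_reals all_analysis.
From mathcomp Require Import measurable_realfun.
From mathcomp Require Import ring lra zify.
Set Implicit Arguments.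
Unset Strict Implicit.
Unset Printing Implicit Defensive.
Import Order.TTheory GRing.Theory Num.Theory.
Import numFieldNormedType.Exports.
Local Open Scope classical_set_scope.
Local Open Scope ring_scope.

(* Passing from level r to level r+1 changes the iterated integral of the
   interpolated path over a dyadic interval by half the sum of
   X (x) Y - Y (x) X, where X and Y are the increments over the two halves of
   the level-r intervals inside it. So it suffices to bound, uniformly over
   dyadic intervals, the increments and these sums; a chaining argument then
   gives Hoelder bounds with exponents h and 2h, uniform in m, for any h below
   min H, and one takes h >= 1/p.
   The diagonal terms vanish. For i <> j the sums are bilinear in independent
   processes. Given one of them, such a sum is Gaussian; its variance is at most
   the largest row sum of the covariance matrix of the increments, which
   telescopes because the variance function t^(2H) is convex or concave, times
   the sum of squares of the frozen increments. This controls all its moments,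
   and Markov's inequality summed over all dyadic intervals gives the almost
   sure bound; the bounds are summable in the level r because min H > 1/4. When
   min H > 1/2 the Hoelder bound alone suffices. *)

(** * Moments of Gaussian laws *)

Section normal_moments.
Context {R : realType}.
Local Notation lambda := (@lebesgue_measure R).

(** All estimates concern values at dyadic times, hence countably many events; the final constant
    depends on the sample point but not on m or the partition. The absolute row sums of the
    covariance matrix of the level-r increments are at most of order 2^(-2Hr) when 2H <= 1, but only
    of order 2^(-r) when 2H > 1. This restricts the conditional argument to exponents h <= 1/2. It
    makes a sum of 2^t products of size 2^(-2h(n+t)) behave like the square root of the number of
    terms, so one further level multiplies the bound by sqrt 2 * 2^(-2h), which is below 1 exactly
    when h > 1/4. The triangle inequality gives the ratio 2 * 2^(-2h) instead, below 1 exactly when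
    h > 1/2. When min H > 1/2 this cruder bound is the right one: p may be below 2, and then 1/p
    exceeds the exponent 1/2 to which the conditional argument is limited. *)

Lemma ge0_integral_normal_prob (m s : R) (f : R -> \bar R) :
  measurable_fun [set: R] f -> (forall x, 0 <= f x)%E ->
  (\int[normal_prob m s]_x f x = \int[lambda]_x (f x * (normal_pdf m s x)%:E))%E.
Proof.
move=> mf f0; have dom := normal_prob_dominates m s.
rewrite -(Radon_Nikodym_SigmaFinite.change_of_variables dom f0 measurableT mf).
apply: ae_eq_integral => //.
- apply: emeasurable_funM => //.
  exact: measurable_int (Radon_Nikodym_SigmaFinite.f_integrable dom).
- by apply: emeasurable_funM => //; apply/measurable_EFinP; apply: measurable_normal_pdf.
(* The Radon-Nikodym derivative and the density have the same integral over every measurable set,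
   hence agree almost everywhere. *)
- apply: ae_eqe_mul2l; apply: integral_ae_eq => //.
  + exact: Radon_Nikodym_SigmaFinite.f_integrable.
  + by apply/measurable_EFinP; exact: measurable_normal_pdf.
  + by move=> E _ mE; rewrite -Radon_Nikodym_SigmaFinite.f_integral.
Qed.

Lemma expr_le_expR (k : nat) (x : R) : 0 <= x -> x ^+ k <= k`!%:R * expR x.
Proof.
move=> x0; case: k => [|k]; first by rewrite expr0 mul1r -expR0 ler_expR.
rewrite mulrC -ler_pdivrMr; last by rewrite ltr0n fact_gt0.
by apply: le_trans (expR_ge1Dxn k x0); rewrite lerDr.
Qed.

Lemma normal_peak_sqrt2 (s : R) :
  normal_peak s = Num.sqrt 2 * normal_peak (Num.sqrt 2 * s).
Proof.
rewrite /normal_peak exprMn sqr_sqrtr//.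
have -> : 2 * s ^+ 2 * pi *+ 2 = 2 * (s ^+ 2 * pi *+ 2) by rewrite -mulrA mulrnAr.
by rewrite sqrtrM// invfM mulrA divff ?mul1r// gt_eqF// sqrtr_gt0.
Qed.

(* The exponential weight turns the density N(m, s) into sqrt 2 times the
   density N(m, sqrt 2 * s), whose mass is known. *)
Lemma normal_central_moment (m s : R) (q : nat) : 0 < s ->
  (\int[normal_prob m s]_x (((x - m) ^+ q.*2)%:E) <=
    (q`!%:R * 4 ^+ q * Num.sqrt 2 * s ^+ q.*2)%:E)%E.
Proof.
move=> s0; set c := q`!%:R * 4 ^+ q * Num.sqrt 2 * s ^+ q.*2.
have c0 : 0 <= c by rewrite /c !mulr_ge0 ?exprn_ge0 ?sqrtr_ge0// ltW.
have sq2 : (0 : R) < Num.sqrt 2 by rewrite sqrtr_gt0.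
have mf : measurable_fun [set: R] (fun x : R => (x - m) ^+ q.*2).
  by apply: measurable_funX; apply: measurable_funB.
rewrite ge0_integral_normal_prob; last 2 first.
- exact/measurable_EFinP.
- by move=> x; rewrite lee_fin -mul2n exprM exprn_ge0// sqr_ge0.
have -> : c%:E = (\int[lambda]_x (c%:E * (normal_pdf m (Num.sqrt 2 * s) x)%:E))%E.
  rewrite ge0_integralZl_EFin//; first by rewrite integral_normal_pdf mule1.
  - by move=> x _; rewrite lee_fin normal_pdf_ge0.
  - by apply/measurable_EFinP; exact: measurable_normal_pdf.
apply: ge0_le_integral => //.
- move=> x _; rewrite -EFinM lee_fin mulr_ge0 ?normal_pdf_ge0//.
  by rewrite -mul2n exprM exprn_ge0// sqr_ge0.
- under eq_fun do rewrite -EFinM.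
  by apply/measurable_EFinP/measurable_funM => //; exact: measurable_normal_pdf.
- under eq_fun do rewrite -EFinM.
  by apply/measurable_EFinP/measurable_funM => //; exact: measurable_normal_pdf.
move=> x _; rewrite -!EFinM lee_fin !normal_pdfE ?gt_eqF ?mulr_gt0//.
rewrite (normal_peak_sqrt2 s).
set pk := normal_peak (Num.sqrt 2 * s).
have pk0 : 0 <= pk := normal_peak_ge0 _.
(* [y] is half the Gaussian exponent, so the weight is exp(-y) twice: one copy absorbs y^q through
   y^q <= q! exp(y), the other is the weight of the wider density. *)
pose y := (x - m) ^+ 2 / (4 * s ^+ 2).
have y0 : 0 <= y by rewrite divr_ge0 ?sqr_ge0// mulr_ge0 ?sqr_ge0.
have sn0 : s != 0 by rewrite gt_eqF.
have -> : normal_fun m s x = expR (- y) * expR (- y).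
  rewrite /normal_fun -expRD; congr expR; rewrite /y -mulr_natl; field.
  by rewrite sn0.
have -> : normal_fun m (Num.sqrt 2 * s) x = expR (- y).
  rewrite /normal_fun exprMn sqr_sqrtr// /y -mulr_natl; congr expR; field.
  by rewrite sn0.
have -> : (x - m) ^+ q.*2 = (4 * s ^+ 2) ^+ q * y ^+ q.
  rewrite -exprMn /y mulrCA divff ?mulf_neq0 ?expf_neq0 ?pnatr_eq0//.
  by rewrite mulr1 -mul2n exprM.
have := expr_le_expR q y0; move/(ler_wpM2r (expR_ge0 (- y))).
rewrite -mulrA expRxMexpNx_1 mulr1 => hy.
have A0 : 0 <= (4 * s ^+ 2) ^+ q * Num.sqrt 2 * pk * expR (- y).
  by rewrite !mulr_ge0 ?expR_ge0 ?exprn_ge0 ?sqrtr_ge0 ?mulr_ge0 ?(ltW s0).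
have := ler_wpM2l A0 hy; rewrite /c exprMn -exprM mul2n.
set E := expR _; set S := s ^+ _; set F := q`!%:R; set Y := y ^+ q.
set f := 4 ^+ q; set t := Num.sqrt 2 => H.
by move: H; congr (is_true (_ <= _)); ring.
Qed.

(** The density never exceeds its peak, which is at most 1 / (2s) because pi >= 2. The bound is
    uniform in the mean, which is what makes it useful below. *)
Lemma normal_small_ball (m s l : R) : 0 < s -> 0 <= l ->
  (normal_prob m s `[(- l)%R, l]%classic <= (l / s)%:E)%E.
Proof.
move=> s0 l0; rewrite /normal_prob.
apply: (@le_trans _ _ (\int[lambda]_(x in `[(- l)%R, l]) (normal_peak s)%:E)%E).
  apply: ge0_le_integral => //=.
  - by move=> x _; rewrite lee_fin normal_pdf_ge0.
  - by apply/measurable_EFinP/measurable_funTS; exact: measurable_normal_pdf.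
  - by move=> x _; rewrite lee_fin normal_pdf_ub// gt_eqF.
rewrite integral_cst//= lebesgue_measure_itv/= lte_fin.
case: ifPn => _; last by rewrite mule0 lee_fin divr_ge0// ltW.
rewrite -EFinD -EFinM lee_fin opprK.
have pi2 : 2 <= pi :> R := pi_ge2 R.
have S0 : 0 < s ^+ 2 * pi *+ 2.
  by rewrite pmulrn_lgt0// mulr_gt0 ?exprn_gt0// (lt_le_trans _ pi2).
have pk : normal_peak s <= (2 * s)^-1.
  rewrite /normal_peak lef_pV2 ?posrE ?sqrtr_gt0 ?mulr_gt0//.
  rewrite -[2 * s](@ger0_norm R) ?mulr_ge0 ?(ltW s0)// -sqrtr_sqr.
  rewrite ler_sqrt ?(ltW S0)//.
  rewrite exprMn -mulrnAr mulrC ler_pM2l ?exprn_gt0//.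
  by rewrite -mulr_natr; lra.
have l2 : 0 <= l + l by rewrite addr_ge0.
apply: le_trans (ler_wpM2r l2 pk) _.
suff -> : (2 * s)^-1 * (l + l) = l / s by [].
by field; exact: lt0r_neq0.
Qed.

End normal_moments.

Section gaussian_moments.
Context {R : realType}.
Local Notation lambda := (@lebesgue_measure R).

(** [gaussian_law] hides its parameters, so they are recovered from the second moment. The ball of
    radius s/2 around 0 has mass at most 1/2, hence x^2 >= s^2/4 on a set of mass at least 1/2. *)
Lemma normal_scale_le_second_moment (m s v : R) : 0 < s ->
  (\int[normal_prob m s]_x (x ^+ 2)%:E <= v%:E)%E -> s ^+ 2 <= 8 * v.
Proof.
move=> s0 hv.
pose I := `[(- (s / 2))%R, (s / 2)%R]%classic : set R.
have mI : measurable I by exact: measurable_itv.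
have NI : (normal_prob m s I <= (2^-1)%:E)%E.
  apply: le_trans (normal_small_ball m s0 _) _; first by rewrite divr_ge0// ltW.
  by rewrite lee_fin mulrAC divff ?gt_eqF// mul1r.
have NCI : ((2^-1)%:E <= normal_prob m s (~` I))%E.
  have /(_ I mI) := probability_setC (normal_prob m s).
  move=> ->; set N := (X in (1 - X)%E).
  have : N \is a fin_num by exact: fin_num_measure.
  have : (N <= (2^-1)%:E)%E := NI.
  case: N => // r; rewrite lee_fin => hr _.
  by rewrite -(EFinB 1 r) lee_fin; lra.
have msq : measurable_fun [set: R] (fun x : R => x ^+ 2).
  exact: measurable_funX.
have : ((s ^+ 2 / 4)%:E * normal_prob m s (~` I) <= v%:E)%E.
  apply: le_trans hv; rewrite -integral_cst; last exact: measurableC.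
  apply: (@le_trans _ _ (\int[normal_prob m s]_(x in ~` I) (x ^+ 2)%:E)%E).
    apply: ge0_le_integral => //=.
    - exact: measurableC.
    - by move=> x _; rewrite lee_fin divr_ge0 ?sqr_ge0.
    - by apply/measurable_EFinP/measurable_funTS.
    - move=> x /= Ix; rewrite lee_fin.
      have : s / 2 <= `|x|.
        rewrite leNgt; apply/negP => xs; apply: Ix; rewrite /I/= in_itv/=.
        by rewrite -ler_norml ltW.
      move=> h; rewrite -[x ^+ 2]real_normK ?num_real//.
      have -> : s ^+ 2 / 4 = (s / 2) ^+ 2 by field.
      by rewrite ler_pXn2r ?nnegrE ?divr_ge0// ltW.
  apply: ge0_subset_integral => //; first exact: measurableC.
  - exact/measurable_EFinP.
  - by move=> x _; rewrite lee_fin sqr_ge0.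
move=> h; have /le_trans/(_ h) : ((s ^+ 2 / 4)%:E * (2^-1)%:E <=
    (s ^+ 2 / 4)%:E * normal_prob m s (~` I))%E.
  by rewrite lee_wpmul2l// lee_fin divr_ge0 ?sqr_ge0.
rewrite -EFinM lee_fin; lra.
Qed.

(** Integrate m^2 <= 2 x^2 + 2 (x - m)^2; the second term costs 2 * 4 sqrt 2 * s^2, and s^2 <= 8
    v. *)
Lemma normal_mean_le_second_moment (m s v : R) : 0 < s ->
  (\int[normal_prob m s]_x (x ^+ 2)%:E <= v%:E)%E ->
  m ^+ 2 <= (2 + 64 * Num.sqrt 2) * v.
Proof.
move=> s0 hv; have hs := normal_scale_le_second_moment s0 hv.
have msq : measurable_fun [set: R] (fun x : R => x ^+ 2).
  exact: measurable_funX.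
have mcq : measurable_fun [set: R] (fun x : R => (x - m) ^+ 2).
  by apply: measurable_funX; apply: measurable_funB.
have hc : (\int[normal_prob m s]_x ((x - m) ^+ 2)%:E <=
    (4 * Num.sqrt 2 * s ^+ 2)%:E)%E.
  apply: le_trans (normal_central_moment m 1 s0) _.
  by rewrite (_ : 1`! = 1%N)// mul1r expr1.
have : ((m ^+ 2)%:E <= 2%:E * (\int[normal_prob m s]_x (x ^+ 2)%:E) +
    2%:E * (\int[normal_prob m s]_x ((x - m) ^+ 2)%:E))%E.
  have -> : ((m ^+ 2)%:E = \int[normal_prob m s]_x (m ^+ 2)%:E)%E.
    by rewrite integral_cst//= probability_setT mule1.
  rewrite -!ge0_integralZl_EFin//; first last.
  - exact/measurable_EFinP.
  - by move=> x _; rewrite lee_fin sqr_ge0.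
  - exact/measurable_EFinP.
  - by move=> x _; rewrite lee_fin sqr_ge0.
  rewrite -ge0_integralD//; first last.
  - by under eq_fun do rewrite -EFinM; apply/measurable_EFinP/measurable_funM.
  - by move=> x _; rewrite -EFinM lee_fin mulr_ge0// sqr_ge0.
  - by under eq_fun do rewrite -EFinM; apply/measurable_EFinP/measurable_funM.
  - by move=> x _; rewrite -EFinM lee_fin mulr_ge0// sqr_ge0.
  apply: ge0_le_integral => //=.
  - by move=> x _; rewrite lee_fin sqr_ge0.
  - under eq_fun do rewrite -!EFinM -EFinD.
    by apply/measurable_EFinP/measurable_funD; apply: measurable_funM.
  - move=> x _; rewrite -!EFinM -EFinD lee_fin -subr_ge0.
    by rewrite (_ : _ - _ = (2 * x - m) ^+ 2) ?sqr_ge0//; ring.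
move=> h; have {h} := le_trans h (leeD (lee_wpmul2l _ hv) (lee_wpmul2l _ hc)).
rewrite !lee_fin => /(_ (ler0n _ 2) (ler0n _ 2)) => h.
apply: le_trans h _.
have := ler_wpM2l (_ : 0 <= 8 * Num.sqrt 2) hs.
rewrite mulr_ge0 ?sqrtr_ge0// => /(_ isT); nra.
Qed.

(** The factor 4^q comes from x^(2q) <= 4^q ((x - m)^(2q) + m^(2q)); the two inner terms bound the
    central moment and the mean through the second moment. The summand 1 covers point masses. *)
Definition gaussian_moment_bound (q : nat) : R :=
  1 + 4 ^+ q * (q`!%:R * 4 ^+ q * Num.sqrt 2 * 8 ^+ q +
     (2 + 64 * Num.sqrt 2) ^+ q).

Lemma gaussian_moment_bound_ge1 q : 1 <= gaussian_moment_bound q.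
Proof.
by rewrite /gaussian_moment_bound lerDl mulr_ge0 ?exprn_ge0// addr_ge0//.
Qed.

Lemma normal_even_moment (m s v : R) (q : nat) : 0 < s ->
  (\int[normal_prob m s]_x (x ^+ 2)%:E <= v%:E)%E ->
  (\int[normal_prob m s]_x (x ^+ q.*2)%:E <= (gaussian_moment_bound q * v ^+ q)%:E)%E.
Proof.
move=> s0 hv; have hs := normal_scale_le_second_moment s0 hv.
have hm := normal_mean_le_second_moment s0 hv.
have hc := normal_central_moment m q s0.
have v0 : 0 <= v.
  by rewrite -(pmulr_rge0 _ (ltr0n R 8)) (le_trans _ hs)// sqr_ge0.
have mcq : measurable_fun [set: R] (fun x : R => (x - m) ^+ q.*2).
  by apply: measurable_funX; apply: measurable_funB.
have mxq : measurable_fun [set: R] (fun x : R => x ^+ q.*2).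
  by apply: measurable_funX.
have ev (x : R) : 0 <= x ^+ q.*2 by rewrite -mul2n exprM exprn_ge0// sqr_ge0.
have ptw (x : R) : x ^+ q.*2 <= 4 ^+ q * (x - m) ^+ q.*2 + 4 ^+ q * m ^+ q.*2.
  rewrite -mul2n !exprM -!exprMn.
  have hx : x ^+ 2 <= 2 * (x - m) ^+ 2 + 2 * m ^+ 2.
    rewrite -subr_ge0 (_ : _ - _ = (x - 2 * m) ^+ 2) ?sqr_ge0//; ring.
  have x0 : 0 <= x ^+ 2 := sqr_ge0 _.
  have a0 : 0 <= 4 * (x - m) ^+ 2 by rewrite mulr_ge0// sqr_ge0.
  have b0 : 0 <= 4 * m ^+ 2 by rewrite mulr_ge0// sqr_ge0.
  have [h|/ltW h] := leP ((x - m) ^+ 2) (m ^+ 2).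
    rewrite -[leLHS]add0r lerD ?exprn_ge0// lerXn2r//; lra.
  rewrite -[leLHS]addr0 lerD ?exprn_ge0// lerXn2r//; lra.
have : (\int[normal_prob m s]_x (x ^+ q.*2)%:E <=
    (4 ^+ q)%:E * (\int[normal_prob m s]_x ((x - m) ^+ q.*2)%:E) +
    (4 ^+ q * m ^+ q.*2)%:E)%E.
  have -> : ((4 ^+ q * m ^+ q.*2)%:E =
      \int[normal_prob m s]_x (4 ^+ q * m ^+ q.*2)%:E)%E.
    by rewrite integral_cst//= probability_setT mule1.
  rewrite -ge0_integralZl_EFin ?exprn_ge0//; first last.
  - exact/measurable_EFinP.
  - by move=> x _; rewrite lee_fin ev.
  rewrite -ge0_integralD//; first last.
  - by move=> x _; rewrite lee_fin mulr_ge0 ?ev ?exprn_ge0.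
  - by under eq_fun do rewrite -EFinM; apply/measurable_EFinP/measurable_funM.
  - by move=> x _; rewrite -EFinM lee_fin mulr_ge0 ?ev ?exprn_ge0.
  apply: ge0_le_integral => //=.
  - by move=> x _; rewrite lee_fin ev.
  - exact/measurable_EFinP.
  - under eq_fun do rewrite -!EFinM -EFinD.
    by apply/measurable_EFinP/measurable_funD => //; apply: measurable_funM.
  - by move=> x _; rewrite -!EFinM -EFinD lee_fin ptw.
move=> h; have q4 : (0 <= (4 ^+ q)%:E :> \bar R)%E by rewrite lee_fin exprn_ge0.
have {h} := le_trans h (leeD (lee_wpmul2l q4 hc) (lexx _)).
rewrite -!EFinM -EFinD => /le_trans; apply; rewrite lee_fin.
rewrite /gaussian_moment_bound mulrDl mul1r mulrDr mulrDl.
rewrite -[leLHS]add0r lerD ?exprn_ge0// lerD//.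
  rewrite -!mulrA ler_wpM2l ?exprn_ge0// ler_wpM2l// ler_wpM2l ?exprn_ge0//.
  rewrite ler_wpM2l ?sqrtr_ge0//.
  by rewrite -mul2n exprM -exprMn lerXn2r// nnegrE ?sqr_ge0// mulr_ge0.
rewrite -mulrA ler_wpM2l ?exprn_ge0// -mul2n exprM -exprMn.
by rewrite lerXn2r// nnegrE ?sqr_ge0// (le_trans _ hm)// sqr_ge0.
Qed.

Lemma gaussian_law_even_moment d (T : measurableType d) (P : probability T R)
    (Y : T -> R) (v : R) (q : nat) :
  measurable_fun setT Y -> gaussian_law P Y ->
  (\int[P]_w (Y w ^+ 2)%:E <= v%:E)%E ->
  (\int[P]_w (Y w ^+ q.*2)%:E <= (gaussian_moment_bound q * v ^+ q)%:E)%E.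
Proof.
move=> mY [m [s [s0 law]]].
pose RT := g_sigma_algebraType R.-ocitv.-measurable.
have mY' : measurable_fun setT (Y : T -> RT) := mY.
pose YM : {mfun T >-> RT} :=
  HB.pack (Y : T -> RT) (isMeasurableFun.Build _ _ _ _ _ mY').
have mX k : measurable_fun [set: RT] (fun x : RT => ((x : R) ^+ k.*2)%:E).
  by apply/measurable_EFinP; apply: measurable_funX.
have push k : (\int[P]_w (Y w ^+ k.*2)%:E =
    \int[distribution P YM]_(x in [set: RT]) ((x : R) ^+ k.*2)%:E)%E.
  rewrite ge0_integral_pushforward//.
  by move=> x _; rewrite lee_fin -mul2n exprM exprn_ge0// sqr_ge0.
rewrite push (push 1).
have [s_eq0|s_neq0] := eqVneq s 0.
  have pE k : (\int[distribution P YM]_(x in [set: RT]) ((x : R) ^+ k.*2)%:E =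
      (m ^+ k.*2)%:E)%E.
    rewrite (eq_measure_integral (\d_ (m : RT))) => [|A mA _]; last first.
      by have := law A mA; rewrite s_eq0 eqxx.
    by rewrite integral_dirac// diracT mul1e.
  rewrite !pE !lee_fin => hm.
  have v0 : 0 <= v by apply: le_trans hm; rewrite sqr_ge0.
  rewrite -mul2n exprM (@le_trans _ _ (v ^+ q))//.
    by rewrite lerXn2r// nnegrE sqr_ge0.
  by rewrite ler_peMl ?exprn_ge0 ?gaussian_moment_bound_ge1.
have pE k : (\int[distribution P YM]_(x in [set: RT]) ((x : R) ^+ k.*2)%:E =
    \int[normal_prob m s]_x (x ^+ k.*2)%:E)%E.
  apply: eq_measure_integral => A mA _.
  by have := law A mA; rewrite (negbTE s_neq0).
by rewrite !pE; apply: normal_even_moment; rewrite lt_def s_neq0.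
Qed.

End gaussian_moments.

(** * Independence *)

Section independence.
Context {R : realType} d (T : measurableType d) (P : probability T R).

(* The two coordinates carry different sigma-algebras, so both factors are
   wrapped in [g_sigma_algebraType] and independence says that the law of the
   diagonal embedding is a product measure. *)
Lemma independent_tonelli (F G : set (set T)) (h : T -> T -> R) :
    F `<=` measurable -> G `<=` measurable ->
    (forall A B, <<s F >> A -> <<s G >> B -> P (A `&` B) = (P A * P B)%E) ->
    measurable_fun [set: g_sigma_algebraType F * g_sigma_algebraType G]
      (fun z => h z.1 z.2) ->
    (forall x y, 0 <= h x y) ->
  (\int[P]_w (h w w)%:E = \int[P]_y \int[P]_x (h x y)%:E)%E.
Proof.
move=> sF sG ind mh h0.
pose TF := g_sigma_algebraType F; pose TG := g_sigma_algebraType G.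
have mF : measurable_fun [set: T] (id : T -> TF).
  move=> _ A mA; rewrite setTI; apply: smallest_sub mA => //.
  exact: sigma_algebra_measurable.
have mG : measurable_fun [set: T] (id : T -> TG).
  move=> _ A mA; rewrite setTI; apply: smallest_sub mA => //.
  exact: sigma_algebra_measurable.
pose diag (w : T) : TF * TG := (w, w).
have mdiag : measurable_fun [set: T] diag by exact/measurable_fun_pairP.
pose XF : {mfun T >-> TF} := HB.pack (id : T -> TF) (isMeasurableFun.Build _ _ _ _ _ mF).
pose XG : {mfun T >-> TG} := HB.pack (id : T -> TG) (isMeasurableFun.Build _ _ _ _ _ mG).
pose XD : {mfun T >-> (TF * TG)%type} := HB.pack diag (isMeasurableFun.Build _ _ _ _ _ mdiag).
pose h' (z : TF * TG) : \bar R := (h z.1 z.2)%:E.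
have mh' : measurable_fun setT h' by exact/measurable_EFinP.
have h'0 z : (0 <= h' z)%E by rewrite lee_fin.
transitivity (\int[distribution P XD]_z h' z)%E.
  by rewrite ge0_integral_pushforward.
transitivity (\int[distribution P XF \x distribution P XG]_z h' z)%E.
  apply: eq_measure_integral => A mA _.
  apply: esym; apply: product_measure_unique => //.
rewrite fubini_tonelli1// fubini_tonelli//.
rewrite ge0_integral_pushforward//=; first last.
- by move=> y _; apply: integral_ge0 => x _; rewrite lee_fin.
- exact: measurable_fun_fubini_tonelli_G.
apply: eq_integral => y _ /=; rewrite /fubini_G ge0_integral_pushforward//.
by apply: measurableT_comp => //; exact: measurable_fun_pair.
Qed.

End independence.

(** The sum of all [W r] has finite expectation, so it is almost surely finite, and it dominates
    each term. *)
Lemma ae_bounded_of_summable (R : realType) d (T : measurableType d)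
    (P : probability T R) (W : nat -> T -> R) (C : R) :
  (forall r, measurable_fun setT (W r)) -> (forall r w, 0 <= W r w) ->
  0 <= C ->
  (forall r, (\int[P]_w (W r w)%:E <= (C / 2 ^+ r)%:E)%E) ->
  {ae P, forall w, exists2 K : R, 0 <= K & forall r, W r w <= K}.
Proof.
move=> mW W0 C0 hW.
pose S w := (\sum_(r <oo) (W r w)%:E)%E.
have mWe r : measurable_fun setT (fun w => (W r w)%:E) by exact/measurable_EFinP.
have S0 w : (0 <= S w)%E by apply: nneseries_ge0 => r _ _; rewrite lee_fin.
have iS : P.-integrable setT S.
  apply/integrableP; split.
    by apply: ge0_emeasurable_sum => // r w _ _; rewrite lee_fin.
  under eq_integral do rewrite gee0_abs//.
  rewrite integral_nneseries//; last by move=> n x _; rewrite lee_fin.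
  apply: (@le_lt_trans _ _ (\sum_(r <oo) ((2 * C) / (2 ^ r.+1)%:R)%:E)%E).
    apply: lee_nneseries => [r _ _|r _]; first
      by apply: integral_ge0 => w _; rewrite lee_fin.
    apply: le_trans (hW r) _; rewrite lee_fin natrX exprS invfM.
    by rewrite mulrACA divff ?mul1r.
  by apply: le_lt_trans (epsilon_trick0 _ _) (ltry _); rewrite mulr_ge0.
have := integrable_ae measurableT iS.
apply: filterS => w /(_ I) fS; exists (fine (S w)); first exact: fine_ge0.
move=> r; rewrite -lee_fin fineK//.
apply: le_trans (nneseries_lim_ge r.+1 _); last by move=> i _ _; rewrite lee_fin.
rewrite big_nat_recr//= leeDr// sume_ge0// => i _; exact: W0.
Qed.

(** * Fractional Brownian increments *)

Section power_increments.
Context {R : realType}.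
Implicit Types (x y a : R) (psi : nat -> R).

Lemma powR_midpoint_convex x y a : 1 <= a -> 0 <= x -> 0 <= y ->
  ((x + y) / 2) `^ a <= (x `^ a + y `^ a) / 2.
Proof.
move=> a1 x0 y0.
have h0 : 0 <= 2^-1 :> R by [].
have h1 : 2^-1 <= 1 :> R by rewrite invf_le1// ler1n.
pose t : {i01 R} := Itv01 h0 h1.
have := @convex_powR R a a1 t x y.
rewrite !inE/= !in_itv/= !andbT => /(_ x0 y0).
rewrite convRE [X in X `^ _ <= _ -> _]convRE/=.
rewrite (_ : unstable.onem 2^-1 = 2^-1); last by rewrite /unstable.onem; field.
by rewrite -!mulrDr !(mulrC 2^-1).
Qed.

(** This is midpoint convexity for the exponent 1/a, applied to x^a and y^a. *)
Lemma powR_midpoint_concave x y a : 0 < a <= 1 -> 0 <= x -> 0 <= y ->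
  (x `^ a + y `^ a) / 2 <= ((x + y) / 2) `^ a.
Proof.
move=> /andP[a0 a1] x0 y0.
have ai : 1 <= a^-1 by rewrite invf_ge1.
have := powR_midpoint_convex ai (powR_ge0 x a) (powR_ge0 y a).
rewrite -!powRrM divff ?gt_eqF// !powRr1// => h.
have e0 : 0 <= (x `^ a + y `^ a) / 2 by rewrite divr_ge0// addr_ge0// powR_ge0.
have {h} := ge0_ler_powR (ltW a0) (_ : _ \in Num.nneg) (_ : _ \in Num.nneg) h.
rewrite -powRrM mulVf ?gt_eqF// powRr1//; apply.
  by rewrite nnegrE powR_ge0.
by rewrite nnegrE divr_ge0// addr_ge0.
Qed.

(** A mean value bound without derivatives: (y^(a-1) - x^(a-1)) (y - x) >= 0 is combined with [key].
    It serves to bound the last increment of a convex variance function. *)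
Lemma powR_sub_le x y a : 1 <= a <= 2 -> 0 <= x <= y ->
  y `^ a - x `^ a <= 2 * y `^ (a - 1) * (y - x).
Proof.
move=> /andP[a1 a2] /andP[x0 xy]; have y0 := le_trans x0 xy.
have a0 : 0 < a by exact: lt_le_trans a1.
have [->|xn0] := eqVneq x 0.
  rewrite powR0 ?gt_eqF// !subr0 -(mulr_powRB1 y0 a0) mulrC -mulrA ler_peMl ?ler1n//.
  by rewrite mulr_ge0// powR_ge0.
have xp : 0 < x by rewrite lt_def xn0.
have yp : 0 < y := lt_le_trans xp xy.
(* t^(a-2) is nonincreasing *)
have key : x * y `^ (a - 1) <= y * x `^ (a - 1).
  have yE : y `^ (a - 1) = x `^ (a - 1) * (y / x) `^ (a - 1).
    by rewrite -powRM ?divr_ge0// mulrCA divff ?mulr1.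
  have : (y / x) `^ (a - 1) <= y / x.
    by apply: ler1_powR; [rewrite ler_pdivlMr ?mul1r|lra].
  move=> /(ler_wpM2l (mulr_ge0 x0 (powR_ge0 x (a - 1)))).
  rewrite -mulrA -yE => /le_trans; apply.
  by rewrite mulrC mulrA divfK ?gt_eqF.
rewrite -(mulr_powRB1 y0 a0) -(mulr_powRB1 x0 a0).
have mono : x `^ (a - 1) <= y `^ (a - 1).
  by apply: ge0_ler_powR => //; rewrite ?nnegrE// subr_ge0.
have := ler_wpM2r (_ : 0 <= y - x) mono; rewrite subr_ge0 => /(_ xy).
move: (x `^ _) (y `^ _) mono key => u v; nra.
Qed.

(* Covariance of two unit increments, [n] steps apart, of a process with
   stationary increments and variance function [psi]. *)
Definition increment_cov psi (n : nat) : R :=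
  if n is k.+1 then (psi k.+2 + psi k) / 2 - psi k.+1 else psi 1%N.

Lemma sum_increment_cov psi n : psi 0%N = 0 ->
  \sum_(k < n) increment_cov psi k.+1 = (psi n.+1 - psi n - psi 1%N) / 2.
Proof.
move=> psi0; elim: n => [|n IHn]; first by rewrite big_ord0 psi0 subr0 subrr mul0r.
by rewrite big_ord_recr/= IHn; field.
Qed.

(** Concavity makes all off-diagonal covariances nonpositive, so their absolute values telescope,
    and monotonicity discards the remaining difference. *)
Lemma increment_cov_sum_concave psi n : psi 0%N = 0 ->
  (forall k, psi k <= psi k.+1) ->
  (forall k, (psi k.+2 + psi k) / 2 <= psi k.+1) ->
  \sum_(k < n) `|increment_cov psi k| <= 2 * psi 1%N.
Proof.
move=> psi0 mono conc; have p1 : 0 <= psi 1%N by rewrite -psi0.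
case: n => [|n]; first by rewrite big_ord0 mulr_ge0.
rewrite big_ord_recl/= ger0_norm// (eq_bigr (fun k : 'I_n => - increment_cov psi k.+1)).
  rewrite sumrN sum_increment_cov//; have := mono n; lra.
by move=> k _; rewrite ler0_norm//= subr_le0.
Qed.

(** Here the off-diagonal covariances are nonnegative, and the difference left by telescoping has
    the wrong sign to be discarded. For t^(2H) it is of the order of the mesh, larger than
    [psi 1]. *)
Lemma increment_cov_sum_convex psi n : psi 0%N = 0 -> 0 <= psi 1%N ->
  (forall k, psi k.+1 <= (psi k.+2 + psi k) / 2) ->
  \sum_(k < n.+1) `|increment_cov psi k| <= psi 1%N + (psi n.+1 - psi n).
Proof.
move=> psi0 p1 conv.
have inc k : psi 1%N <= psi k.+1 - psi k.
  elim: k => [|k IHk]; first by rewrite psi0 subr0.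
  by have := conv k; lra.
rewrite big_ord_recl/= ger0_norm// (eq_bigr (fun k : 'I_n => increment_cov psi k.+1)).
  rewrite sum_increment_cov//; have := inc n; lra.
by move=> k _; rewrite ger0_norm//= subr_ge0.
Qed.

(** With truncated subtraction, (p - q) + (q - p) is the distance |p - q|; each distance occurs at
    most twice in a row of the matrix. *)
Lemma sum_dist_le (g : nat -> R) (M p : nat) : (forall n, 0 <= g n) -> (p < M)%N ->
  \sum_(q < M) g ((p - q) + (q - p))%N <= 2 * \sum_(k < M) g k.
Proof.
move=> g0 pM; rewrite -(big_mkord xpredT (fun q => g ((p - q) + (q - p))%N)).
rewrite (@big_cat_nat _ _ _ p.+1)//= mulr_natl mulr2n lerD//.
  rewrite big_mkord (reindex_inj rev_ord_inj)/=.
  rewrite (eq_bigr (fun k : 'I_p.+1 => g k)); last first.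
    by move=> k _; congr g; have := ltn_ord k; lia.
  rewrite -(big_mkord xpredT g) -(big_mkord xpredT g).
  rewrite [leRHS](@big_cat_nat _ _ _ p.+1)//= lerDl.
  by rewrite sumr_ge0.
rewrite -{1}[p.+1]add0n big_addn -(big_mkord xpredT g).
rewrite [leRHS](@big_cat_nat _ _ _ (M - p.+1).+1)//=; last by lia.
rewrite big_nat_recl//= addrAC -[leLHS]add0r lerD//.
  by rewrite addr_ge0// sumr_ge0.
by apply: ler_sum => i _; rewrite (_ : _ + _ = i.+1)%N//; lia.
Qed.

End power_increments.

Section fbm_moments.
Context {R : realType} d (T : measurableType d) (P : probability T R).
Variables (I : set R) (H : R) (X : R -> {RV P >-> R}).
Hypothesis X_fbm : is_fbm I H X.
Hypothesis H_gt0 : 0 < H.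

Let fbm_prodE s t : I s -> I t ->
  (\int[P]_w (X s w * X t w)%:E =
   ((s `^ (2 * H) + t `^ (2 * H) - `|t - s| `^ (2 * H)) / 2)%:E)%E.
Proof.
case: X_fbm => _ E0 C Is It; rewrite -C// covariance.unlock !E0//= unlock.
apply: eq_integral => w _ /=.
by transitivity (((X s w - 0) * (X t w - 0))%:E); first by rewrite !subr0.
Qed.

Let fbm_prod_integrable s t : I s -> I t ->
  P.-integrable setT (fun w => (X s w * X t w)%:E).
Proof.
move=> Is It.
have sq u : I u -> P.-integrable setT (fun w => (X u w ^+ 2)%:E).
  move=> Iu; apply/integrableP; split.
    by apply/measurable_EFinP; apply: measurable_funX.
  under eq_integral do rewrite gee0_abs ?lee_fin ?sqr_ge0// expr2.
  by rewrite fbm_prodE// ltry.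
apply: (le_integrable measurableT _ _ (integrableD measurableT (sq s Is) (sq t It))).
  by apply/measurable_EFinP; apply: measurable_funM.
move=> w _ /=; rewrite lee_fin.
rewrite [leRHS](ger0_norm (addr_ge0 (sqr_ge0 (X s w)) (sqr_ge0 (X t w)))).
rewrite ler_norml; apply/andP; split; rewrite -subr_ge0.
  by rewrite (_ : _ - _ = ((X s w + X t w) ^+ 2 + X s w ^+ 2 + X t w ^+ 2) / 2);
    [rewrite divr_ge0// !addr_ge0 ?sqr_ge0|field].
by rewrite (_ : _ - _ = ((X s w - X t w) ^+ 2 + X s w ^+ 2 + X t w ^+ 2) / 2);
  [rewrite divr_ge0// !addr_ge0 ?sqr_ge0|field].
Qed.

Variables (delta : R) (M : nat).
Hypothesis delta_ge0 : 0 <= delta.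
Hypothesis grid : forall k, (k <= M)%N -> I (k%:R * delta).

Let inc k w := X (k.+1%:R * delta) w - X (k%:R * delta) w.
Let psi k : R := (k%:R * delta) `^ (2 * H).

Let inc_prod_expand p q w : (inc p w * inc q w)%:E =
  ((X (p.+1%:R * delta) w * X (q.+1%:R * delta) w)%:E
   - (X (p.+1%:R * delta) w * X (q%:R * delta) w)%:E
   - ((X (p%:R * delta) w * X (q.+1%:R * delta) w)%:E
      - (X (p%:R * delta) w * X (q%:R * delta) w)%:E))%E.
Proof. by rewrite -!EFinB; congr EFin; rewrite /inc; ring. Qed.

Let inc_prod_integrable p q : (p < M)%N -> (q < M)%N ->
  P.-integrable setT (fun w => (inc p w * inc q w)%:E).
Proof.
move=> pM qM; under eq_fun do rewrite inc_prod_expand.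
by apply: integrableB => //; apply: integrableB => //;
  apply: fbm_prod_integrable; apply: grid; rewrite // ltnW.
Qed.

Let dist_psi p q : `|q%:R * delta - p%:R * delta| `^ (2 * H) =
  psi ((p - q) + (q - p))%N.
Proof.
rewrite /psi -mulrBl normrM (ger0_norm delta_ge0); congr ((_ * _) `^ _).
have [pq|/ltnW pq] := leqP p q.
  rewrite -natrB// ger0_norm// (eqP pq : (p - q = 0)%N) add0n//.
by rewrite distrC -natrB// ger0_norm// (eqP pq : (q - p = 0)%N) addn0.
Qed.

(** In the four-term expansion the variances at single times cancel, leaving a second difference of
    [psi] at the distance |p - q|. *)
Lemma fbm_increment_cov p q : (p < M)%N -> (q < M)%N ->
  (\int[P]_w (inc p w * inc q w)%:E =
     (increment_cov psi ((p - q) + (q - p)))%:E)%E.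
Proof.
move=> pM qM.
have Ip := grid (ltnW pM); have Iq := grid (ltnW qM).
have Ip1 := grid pM; have Iq1 := grid qM.
under eq_integral do rewrite inc_prod_expand.
have i2 s1 s2 s3 : I s1 -> I s2 -> I s3 -> P.-integrable setT
    (fun w => (X s1 w * X s2 w)%:E - (X s1 w * X s3 w)%:E)%E.
  by move=> *; apply: integrableB => //; apply: fbm_prod_integrable.
have e2 s1 s2 s3 : I s1 -> I s2 -> I s3 ->
    (\int[P]_w ((X s1 w * X s2 w)%:E - (X s1 w * X s3 w)%:E) =
     \int[P]_w (X s1 w * X s2 w)%:E - \int[P]_w (X s1 w * X s3 w)%:E)%E.
  by move=> *; rewrite integralB//; apply: fbm_prod_integrable.
rewrite integralB//; [|exact: i2..].
rewrite !e2// !fbm_prodE// !dist_psi -!EFinB; congr EFin; rewrite !subSS.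
have psi0 : psi 0 = 0 by rewrite /psi mul0r powR0// gt_eqF// mulr_gt0.
rewrite -!/(psi _).
have [[->|[k qE]]|[k pE]] : (p = q \/ exists k, q = (p + k.+1)%N) \/
    exists k, p = (q + k.+1)%N.
- have [->|neq] := eqVneq p q; first by left; left.
  by have [pq|pq] := ltnP p q; [left; right; exists (q - p).-1|right; exists (p - q).-1]; lia.
- have -> : (q.+1 - q + (q - q.+1) = 1)%N by lia.
  have -> : (q - q.+1 + (q.+1 - q) = 1)%N by lia.
  rewrite subnn addn0 psi0 [RHS]/=.
  by move: (psi q.+1) (psi q) (psi 1) => u v z; field.
- have -> : (p - q + (q - p) = k.+1)%N by lia.
  have -> : (p.+1 - q + (q - p.+1) = k)%N by lia.
  have -> : (p - q.+1 + (q.+1 - p) = k.+2)%N by lia.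
  rewrite [RHS]/=; move: (psi p.+1) (psi q.+1) (psi p) (psi q) (psi k) (psi k.+1).
  by move: (psi k.+2) => *; field.
- have -> : (p - q + (q - p) = k.+1)%N by lia.
  have -> : (p.+1 - q + (q - p.+1) = k.+2)%N by lia.
  have -> : (p - q.+1 + (q.+1 - p) = k)%N by lia.
  rewrite [RHS]/=; move: (psi p.+1) (psi q.+1) (psi p) (psi q) (psi k) (psi k.+1).
  by move: (psi k.+2) => *; field.
Qed.

(** Schur's test: |y_p y_q| <= (y_p^2 + y_q^2) / 2, so absolute row sums control the quadratic form.
    The factor 2 is that of [sum_dist_le]. *)
Lemma fbm_increment_comb_second_moment (y : nat -> R) :
  (\int[P]_w ((\sum_(p < M) y p * inc p w) ^+ 2)%:E <=
    (2 * (\sum_(k < M) `|increment_cov psi k|) * \sum_(p < M) y p ^+ 2)%:E)%E.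
Proof.
pose g k := `|increment_cov psi k|.
have -> : (\int[P]_w ((\sum_(p < M) y p * inc p w) ^+ 2)%:E =
    \int[P]_w (\sum_(p < M) \sum_(q < M) (y p * y q)%:E * (inc p w * inc q w)%:E))%E.
  apply: eq_integral => w _; rewrite expr2 big_distrl/= -sumEFin.
  apply: eq_bigr => p _; rewrite big_distrr/= -sumEFin; apply: eq_bigr => q _.
  by rewrite -EFinM mulrACA.
have ii (p q : 'I_M) : P.-integrable setT
    (fun w => (y p * y q)%:E * (inc p w * inc q w)%:E)%E.
  by apply: integrableZl => //; apply: inc_prod_integrable.
rewrite integral_sum//; last by move=> p; apply: integrable_sum.
under eq_bigr do rewrite integral_sum//.
have ie (p q : 'I_M) : (\int[P]_w ((y p * y q)%:E * (inc p w * inc q w)%:E) =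
    (y p * y q * increment_cov psi ((p - q) + (q - p))%N)%:E)%E.
  by rewrite integralZl ?fbm_increment_cov//; apply: inc_prod_integrable.
under eq_bigr do under eq_bigr do rewrite ie.
under eq_bigr do rewrite sumEFin.
rewrite sumEFin lee_fin.
apply: (@le_trans _ _ (\sum_(p < M) \sum_(q < M)
    (y p ^+ 2 / 2 * g ((p - q) + (q - p))%N +
     y q ^+ 2 / 2 * g ((p - q) + (q - p))%N))).
  apply: ler_sum => p _; apply: ler_sum => q _; rewrite -mulrDl.
  apply: le_trans (ler_norm _) _; rewrite normrM ler_wpM2r//.
  rewrite normrM -(real_normK (num_real (y p))) -(real_normK (num_real (y q))).
  by rewrite -subr_ge0 (_ : _ - _ = (`|y p| - `|y q|) ^+ 2 / 2);
    [rewrite divr_ge0 ?sqr_ge0|field].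
have half : \sum_(p < M) \sum_(q < M) y p ^+ 2 / 2 * g ((p - q) + (q - p))%N <=
    (\sum_(k < M) g k) * \sum_(p < M) y p ^+ 2.
  rewrite mulr_sumr; apply: ler_sum => p _; rewrite -mulr_sumr.
  have := sum_dist_le (fun n => normr_ge0 (increment_cov psi n)) (ltn_ord p).
  rewrite -/g => /(ler_wpM2l (_ : 0 <= y p ^+ 2 / 2)) h.
  apply: le_trans (h _) _; first by rewrite divr_ge0 ?sqr_ge0.
  by rewrite [X in X <= _](_ : _ = (\sum_(k < M) g k) * y p ^+ 2)//; field.
have -> : \sum_(p < M) \sum_(q < M)
    (y p ^+ 2 / 2 * g ((p - q) + (q - p))%N +
     y q ^+ 2 / 2 * g ((p - q) + (q - p))%N) =
   \sum_(p < M) \sum_(q < M) y p ^+ 2 / 2 * g ((p - q) + (q - p))%N +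
   \sum_(p < M) \sum_(q < M) y p ^+ 2 / 2 * g ((p - q) + (q - p))%N.
  under eq_bigr do rewrite big_split/=.
  rewrite big_split/=; congr (_ + _); rewrite exchange_big/=.
  by apply: eq_bigr => p _; apply: eq_bigr => q _; rewrite addnC.
by rewrite -mulrA mulr_natl mulr2n lerD.
Qed.

(** Split into 2M point values: right endpoints with weight y, left endpoints with weight -y. Times
    may repeat in [gaussian_process]. *)
Lemma fbm_increment_comb_gaussian (y : nat -> R) :
  gaussian_law P (fun w => \sum_(p < M) y p * inc p w).
Proof.
case: X_fbm => gX _ _.
pose t (i : 'I_(M + M)) : R :=
  match fintype.split i with inl k => k.+1%:R * delta | inr k => k%:R * delta end.
pose c (i : 'I_(M + M)) : R :=
  match fintype.split i with inl k => y k | inr k => - y k end.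
have := gX _ t c; rewrite (_ : (fun w => \sum_i c i * X (t i) w) =
    (fun w => \sum_(p < M) y p * inc p w)).
  apply=> i; rewrite /t; case: (fintype.split i) => k; apply: grid => //; exact: ltnW.
apply/funext => w; rewrite big_split_ord/= -big_split/=; apply: eq_bigr => k _.
by rewrite /c /t !(unsplitK (inl k)) !(unsplitK (inr k)) /inc mulrBr mulNr.
Qed.

End fbm_moments.

Definition dyadic_increment {R : realType} (T : R) (x : R -> R) (r k : nat) : R :=
  x (dyadic_time T r k.+1) - x (dyadic_time T r k).

Section dyadic_fbm.
Context {R : realType} d (Omega : measurableType d) (P : probability Omega R).
Variables (T H : R) (X : R -> {RV P >-> R}).
Hypothesis T_gt0 : 0 < T.
Hypothesis H01 : 0 < H < 1.
Hypothesis X_fbm : is_fbm `[0, T] H X.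

Let H_gt0 : 0 < H. Proof. by case/andP: H01. Qed.

Lemma powR_expN2 (a : R) r : (2 ^- r) `^ a = (2 `^ (- a)) ^+ r.
Proof.
rewrite -powR_invn//.
rewrite -(powR_mulrn _ (powR_ge0 2 (- a))) -!powRrM.
congr (_ `^ _).
by rewrite mulNr mulrC mulNr.
Qed.

Lemma sqr_powR2N (a : R) r : ((2 `^ (- a)) ^+ r) ^+ 2 = (2 `^ (- (2 * a))) ^+ r.
Proof.
rewrite -exprM mulnC exprM; congr (_ ^+ _).
rewrite -(powR_mulrn _ (powR_ge0 2 (- a))) -powRrM.
by congr (_ `^ _); rewrite mulNr mulrC.
Qed.

Let delta r := 2 ^- r * T.

Let delta_gt0 r : 0 < delta r.
Proof. by rewrite mulr_gt0// invr_gt0 exprn_gt0. Qed.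

Let dyadic_timeE r k : dyadic_time T r k = k%:R * delta r.
Proof. by rewrite /dyadic_time mulrA. Qed.

Let delta_exp r (a : R) : delta r `^ a = T `^ a * (2 `^ (- a)) ^+ r.
Proof. by rewrite powRM ?powR_expN2 1?mulrC// ltW. Qed.

Let grid r k : (k <= 2 ^ r)%N -> `[0, T]%classic (k%:R * delta r).
Proof.
move=> kr /=; rewrite in_itv/= mulr_ge0 ?(ltW (delta_gt0 r))//= /delta mulrA.
rewrite ger_pMl// ler_pdivrMr ?exprn_gt0// mul1r -natrX ler_nat//.
Qed.

Lemma measurable_dyadic_increment r k :
  measurable_fun setT (fun w => dyadic_increment T (X^~ w) r k).
Proof. exact: measurable_funB. Qed.

Lemma dyadic_increment_moment (q : nat) : exists2 C : R, 0 <= C &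
  forall r k, (k < 2 ^ r)%N ->
  (\int[P]_w ((dyadic_increment T (X^~ w) r k) ^+ q.*2)%:E <=
    (C * ((2 `^ (- H)) ^+ r) ^+ q.*2)%:E)%E.
Proof.
exists (gaussian_moment_bound q * (T `^ (2 * H)) ^+ q).
  by rewrite mulr_ge0 ?exprn_ge0 ?powR_ge0// (le_trans _ (gaussian_moment_bound_ge1 q)).
move=> r k kr; rewrite -mulrA.
rewrite -mul2n exprM -exprMn.
rewrite mul2n; apply: gaussian_law_even_moment; first exact: measurable_dyadic_increment.
  have := fbm_increment_comb_gaussian X_fbm (grid (r := r)) (fun j => (j == k)%:R).
  congr (gaussian_law P _); apply/funext => w.
  rewrite (bigD1 (Ordinal kr))//= eqxx mul1r big1 ?addr0.
    by rewrite /dyadic_increment !dyadic_timeE.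
  by move=> i; rewrite -val_eqE/= => /negbTE ->; rewrite mul0r.
under eq_integral do rewrite /dyadic_increment !dyadic_timeE expr2.
rewrite (fbm_increment_cov X_fbm H_gt0 (ltW (delta_gt0 r)) (grid (r := r)) kr kr).
rewrite subnn/= mul1r delta_exp lee_fin ler_wpM2l ?powR_ge0//.
by rewrite sqr_powR2N.
Qed.

(** The concave case yields the mesh to the power 2H. In the convex case the last difference T^(2H)
    - (T - delta)^(2H) yields only the first power; hence the two upper bounds on h. *)
Let increment_cov_sum_dyadic (h : R) : 0 < h <= H -> h <= 1 / 2 ->
  exists2 C : R, 0 <= C & forall r,
   \sum_(k < 2 ^ r) `|increment_cov (fun k => (k%:R * delta r) `^ (2 * H)) k| <=
   C * ((2 `^ (- h)) ^+ r) ^+ 2.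
Proof.
move=> /andP[h0 hH] h2.
have bmono (a a' : R) r : a <= a' -> (2 `^ (- a')) ^+ r <= (2 `^ (- a)) ^+ r.
  move=> aa'; rewrite lerXn2r ?nnegrE ?powR_ge0//.
  by rewrite ler_powR ?lerN2// ler1n.
have p1 r : (1%:R * delta r) `^ (2 * H) <= T `^ (2 * H) * ((2 `^ (- h)) ^+ r) ^+ 2.
  by rewrite mul1r delta_exp sqr_powR2N ler_wpM2l ?powR_ge0// bmono// ler_pM2l.
have psi0 r : (0%:R * delta r) `^ (2 * H) = 0.
  by rewrite mul0r powR0// gt_eqF// mulr_gt0.
have arg0 r k : 0 <= k%:R * delta r by rewrite mulr_ge0// ltW.
have mid r k : (k.+2%:R * delta r + k%:R * delta r) / 2 = k.+1%:R * delta r.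
  by rewrite -!natr1; field.
have mono r k : k%:R * delta r <= k.+1%:R * delta r.
  by rewrite ler_pM2r// ler_nat.
have [H2|H2] := lerP (2 * H) 1.
  exists (2 * T `^ (2 * H)); first by rewrite mulr_ge0 ?powR_ge0.
  move=> r; apply: (le_trans (increment_cov_sum_concave _ _ _ _)) => //.
  - by move=> k; rewrite ge0_ler_powR ?nnegrE// mulr_ge0// ltW.
  - move=> k /=; rewrite -(mid r k). apply: powR_midpoint_concave => //.
    by rewrite mulr_gt0.
  - by rewrite -mulrA ler_pM2l.
exists (T `^ (2 * H) + 2 * T `^ (2 * H - 1) * T).
  by rewrite addr_ge0 ?mulr_ge0 ?powR_ge0 ?(ltW T_gt0).
move=> r; have e0 : (0 < 2 ^ r)%N by rewrite expn_gt0.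
rewrite -(prednK e0).
apply: (le_trans (increment_cov_sum_convex _ _ _ _)) => //.
- exact: powR_ge0.
- by move=> k /=; rewrite -(mid r k); apply: powR_midpoint_convex => //; exact: ltW.
rewrite [leRHS]mulrDl lerD// prednK//.
apply: (le_trans (powR_sub_le _ _)).
- by rewrite ltW//=; case/andP: H01 => _ ?; lra.
- by rewrite arg0 -{2}(prednK e0) mono.
have -> : (2 ^ r)%:R * delta r = T.
  by rewrite /delta mulrA natrX divff ?mul1r// expf_neq0.
have -> : T - (2 ^ r).-1%:R * delta r = delta r.
  rewrite -[in LHS](_ : (2 ^ r)%:R * delta r = T); last first.
    by rewrite /delta mulrA natrX divff ?mul1r// expf_neq0.
  by rewrite -{1}(prednK e0) -natr1; ring.
rewrite -!mulrA !ler_wpM2l ?powR_ge0// sqr_powR2N /delta mulrC ler_pM2l//.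
rewrite -[2 ^- r]powRr1; last by rewrite invr_ge0 exprn_ge0.
by rewrite powR_expN2 bmono//; lra.
Qed.

(** [C] is independent of the coefficients, so that increments of an independent process can be
    substituted for them. *)
Lemma dyadic_increment_comb_moment (h : R) (q : nat) : 0 < h <= H -> h <= 1 / 2 ->
  exists2 C : R, 0 <= C & forall r (y : nat -> R),
  (\int[P]_w ((\sum_(k < 2 ^ r) y k * dyadic_increment T (X^~ w) r k) ^+ q.*2)%:E <=
    (C * (((2 `^ (- h)) ^+ r) ^+ 2 * \sum_(k < 2 ^ r) y k ^+ 2) ^+ q)%:E)%E.
Proof.
move=> hH h2; have [C C0 HC] := increment_cov_sum_dyadic hH h2.
exists (gaussian_moment_bound q * (2 * C) ^+ q).
  by rewrite mulr_ge0 ?exprn_ge0 ?mulr_ge0// (le_trans _ (gaussian_moment_bound_ge1 q)).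
move=> r y; rewrite -mulrA -exprMn.
have incE w : \sum_(k < 2 ^ r) y k * dyadic_increment T (X^~ w) r k =
    \sum_(k < 2 ^ r) y k * (X (k.+1%:R * delta r) w - X (k%:R * delta r) w).
  by apply: eq_bigr => k _; rewrite /dyadic_increment !dyadic_timeE.
apply: gaussian_law_even_moment.
- apply: measurable_sum => k; apply: measurable_funM => //.
  exact: measurable_dyadic_increment.
- have := fbm_increment_comb_gaussian X_fbm (grid (r := r)) y.
  by congr (gaussian_law P _); apply/funext => w; rewrite incE.
- under eq_integral do rewrite incE.
  have := fbm_increment_comb_second_moment X_fbm H_gt0 (ltW (delta_gt0 r)) (grid (r := r)) y.
  move=> /le_trans; apply; rewrite lee_fin mulrA ler_wpM2r ?sumr_ge0//.
    by move=> k _; rewrite sqr_ge0.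
  by rewrite -mulrA ler_pM2l.
Qed.

End dyadic_fbm.

(** * Almost sure dyadic bounds *)

(* Markov's inequality for the 2q-th moments, summed over the levels r. *)
Lemma ae_bounded_of_moments (R : realType) d (Omega : measurableType d)
    (P : probability Omega R) (J : nat -> finType)
    (Z : forall r, J r -> Omega -> R) (s : forall r, J r -> R) (e : nat -> R)
    (C : R) (q : nat) :
  (0 < q)%N -> 0 <= C -> (forall r j, measurable_fun setT (Z r j)) ->
  (forall r j, 0 < s r j) ->
  (forall r, #|J r|%:R * e r <= C / 2 ^+ r) ->
  (forall r j, (\int[P]_w (Z r j w ^+ q.*2)%:E <= (e r * s r j ^+ q.*2)%:E)%E) ->
  {ae P, forall w, exists2 K : R, 0 <= K & forall r j, `|Z r j w| <= K * s r j}.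
Proof.
move=> q0 C0 mZ s0 card mom.
have ev (x : R) : 0 <= x ^+ q.*2 by rewrite -mul2n exprM exprn_ge0// sqr_ge0.
pose W r w := \sum_(j : J r) (Z r j w / s r j) ^+ q.*2.
have mW r j : measurable_fun setT (fun w => (Z r j w / s r j) ^+ q.*2).
  by apply: measurable_funX; apply: measurable_funM.
have := @ae_bounded_of_summable R d Omega P W C _ _ C0 _.
move=> /(_ (fun r => measurable_sum _ (mW r))) /(_ (fun r w => sumr_ge0 _ (fun j _ => ev _))).
have bound r : (\int[P]_w (W r w)%:E <= (C / 2 ^+ r)%:E)%E.
  under eq_integral do rewrite /W -sumEFin.
  rewrite ge0_integral_sum//; first last.
  - by move=> j w _; rewrite lee_fin ev.
  - by move=> j; apply/measurable_EFinP.
  apply: (@le_trans _ _ (\sum_(j : J r) (e r)%:E)%E); last first.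
    rewrite sumEFin lee_fin (_ : \sum_(j : J r) e r = #|J r|%:R * e r) ?card//.
    by rewrite sumr_const mulr_natl; congr (_ *+ _); apply: eq_card.
  apply: lee_sum => j _.
  under eq_integral do rewrite exprMn mulrC EFinM.
  rewrite ge0_integralZl_EFin ?ev//; first last.
  - by apply/measurable_EFinP; apply: measurable_funX.
  - by move=> w _; rewrite lee_fin ev.
  apply: le_trans (lee_wpmul2l _ (mom r j)) _; first by rewrite lee_fin ev.
  rewrite -EFinM lee_fin exprVn mulrCA mulVf ?mulr1//.
  by rewrite expf_neq0// gt_eqF.
(* The constant 1 + K avoids a 2q-th root: a ratio x > 1 + K would satisfy x <= x^(2q) <= K. *)
move=> /(_ bound); apply: filterS => w [K K0 HK]; exists (1 + K) => [|r j].
  by rewrite addr_ge0.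
have sp := s0 r j; rewrite -ler_pdivrMr//.
have -> : `|Z r j w| / s r j = `|Z r j w / s r j|.
  by rewrite normrM normfV (gtr0_norm sp).
have : (Z r j w / s r j) ^+ q.*2 <= K.
  apply: le_trans (HK r); rewrite /W (bigD1 j)//= lerDl sumr_ge0// => i _; exact: ev.
set x := `|Z r j w / s r j| => xK.
have xE : x ^+ q.*2 = (Z r j w / s r j) ^+ q.*2.
  by rewrite /x -mul2n !exprM real_normK ?num_real.
rewrite leNgt; apply/negP => Kx.
have x1 : 1 <= x by apply: le_trans (ltW Kx); rewrite lerDl.
have : x <= x ^+ q.*2 by rewrite ler_eXnr// double_gt0.
rewrite xE; move: xK Kx; lra.
Qed.

Section increments_ae.
Context {R : realType} d (Omega : measurableType d) (P : probability Omega R).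
Variables (T : R).
Hypothesis T_gt0 : 0 < T.

Lemma powR2N_gt0 (h : R) r : 0 < (2 `^ (- h)) ^+ r.
Proof. by rewrite exprn_gt0// powR_gt0. Qed.

Lemma powR2N_ratio (h h' : R) (k q : nat) : k%:R <= q%:R * (h - h') ->
  (2 `^ (- h)) ^+ q <= 2 ^- k * (2 `^ (- h')) ^+ q.
Proof.
move=> kq; rewrite -(powR_mulrn _ (powR_ge0 2 (- h))) -(powR_mulrn _ (powR_ge0 2 (- h'))).
rewrite -!powRrM -powR_invn// -powRD; last by rewrite pnatr_eq0/= implybT.
by apply: ler_powR; [rewrite ler1n|move: kq; rewrite mulrBr; lra].
Qed.

Lemma dyadic_increment_ae (H h : R) (X : R -> {RV P >-> R}) :
  0 < H < 1 -> h < H -> is_fbm `[0, T] H X ->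
  {ae P, forall w, exists2 K : R, 0 <= K & forall r k, (k < 2 ^ r)%N ->
     `|dyadic_increment T (X^~ w) r k| <= K * (2 `^ (- h)) ^+ r}.
Proof.
move=> H01 hH X_fbm.
have dH : 0 < H - h by rewrite subr_gt0.
(* With q (H - h) >= 1 the normalized 2q-th moments are of order 4^(-r), which leaves 2^(-r) after
   summing over 2^r intervals. *)
pose q := (Num.truncn (H - h)^-1).+1.
have hq : 1 <= q%:R * (H - h).
  rewrite -ler_pdivrMr// mul1r ltW// /q.
  exact: truncnS_gt.
have [C C0 HC] := dyadic_increment_moment T_gt0 H01 X_fbm q.
have := @ae_bounded_of_moments R d Omega P (fun r => 'I_(2 ^ r))
  (fun r k w => dyadic_increment T (X^~ w) r k) (fun r _ => (2 `^ (- h)) ^+ r)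
  (fun r => C * (4 ^- r)) C q isT C0.
move=> /(_ (fun r j => measurable_dyadic_increment T X r j)).
move=> /(_ (fun r j => powR2N_gt0 h r)).
have card r : #|'I_(2 ^ r)|%:R * (C * 4 ^- r) <= C / 2 ^+ r.
  rewrite card_ord natrX mulrCA ler_wpM2l// (_ : 4 = 2 * 2 :> R); last by ring.
  by rewrite exprMn invfM mulrA divff ?mul1r// expf_neq0.
have mom r (j : 'I_(2 ^ r)) :
    (\int[P]_w (dyadic_increment T (X^~ w) r j ^+ q.*2)%:E <=
     (C * 4 ^- r * ((2 `^ (- h)) ^+ r) ^+ q.*2)%:E)%E.
  apply: le_trans (HC r j (ltn_ord j)) _.
  rewrite lee_fin -mulrA ler_wpM2l//.
  rewrite -!exprM [(r * _)%N]mulnC !exprM -exprVn -exprMn.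
  have n0 (a : R) : 0 <= (2 `^ a) ^+ q.*2 by rewrite exprn_ge0// powR_ge0.
  have n1 : 0 <= 4^-1 * (2 `^ (- h)) ^+ q.*2 by rewrite mulr_ge0// n0.
  rewrite lerXn2r ?nnegrE//.
  rewrite (_ : 4 = 2 ^+ 2 :> R); last by rewrite -natrX.
  by apply: powR2N_ratio; rewrite -muln2 natrM -mulrA mulrCA ler_peMr.
move=> /(_ card mom); apply: filterS.
by move=> w [K K0 HK]; exists K => // r k kr; exact: (HK r (Ordinal kr)).
Qed.

End increments_ae.

(* Each level-(n+t) interval inside the l-th level-n interval contributes the
   product of the increment of x over its first half and that of y over its
   second half. *)
Definition dyadic_area {R : realType} (T : R) (x y : R -> R) (n t l : nat) : R :=
  \sum_(q < 2 ^ t)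
    dyadic_increment T x (n + t).+1 (l * 2 ^ t + q).*2 *
    dyadic_increment T y (n + t).+1 (l * 2 ^ t + q).*2.+1.

(** The sum is at most m times its largest term. Jensen's inequality would give the exponent q - 1;
    the lost factor m is harmless once q is large. *)
Lemma sum_expr_le {R : realType} (m q : nat) (a : nat -> R) : (0 < q)%N ->
  (forall i, 0 <= a i) ->
  (\sum_(i < m) a i) ^+ q <= m%:R ^+ q * \sum_(i < m) a i ^+ q.
Proof.
move=> q0 a0; case: m => [|m]; first by rewrite !big_ord0 mulr0 expr0n gtn_eqF.
pose i := [arg max_(i > (ord0 : 'I_m.+1)) a i]%O.
have iP (j : 'I_m.+1) : a j <= a i.
  by rewrite /i; case: arg_maxP => // k _; apply.
apply: (@le_trans _ _ ((m.+1%:R * a i) ^+ q)).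
  rewrite lerXn2r ?nnegrE ?mulr_ge0 ?sumr_ge0//.
  apply: le_trans (ler_sum _ (fun j _ => iP j)) _.
  by rewrite sumr_const card_ord mulr_natl.
rewrite exprMn ler_wpM2l ?exprn_ge0// (bigD1 i)//= lerDl sumr_ge0// => j _.
exact: exprn_ge0.
Qed.

Section sum_supported.
Context {R : realType}.
Variables (m M : nat) (sigma : nat -> nat) (c : nat -> R).
Hypothesis sigma_inj : injective sigma.
Hypothesis sigma_lt : forall i, (i < m)%N -> (sigma i < M)%N.

Let y k : R := \sum_(i < m) (k == sigma i)%:R * c i.

(** The moment bound sums over all intervals of a level, an area only over some of them; [y] extends
    the coefficients by zero. *)
Lemma sum_supported (f : nat -> R) :
  \sum_(k < M) y k * f k = \sum_(i < m) c i * f (sigma i).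
Proof.
rewrite /y; under eq_bigr do rewrite mulr_suml.
rewrite exchange_big/=; apply: eq_bigr => i _.
rewrite (bigD1 (Ordinal (sigma_lt (ltn_ord i))))//= eqxx mul1r big1 ?addr0// => k.
by rewrite -val_eqE/= => /negbTE ->; rewrite !mul0r.
Qed.

Lemma sum_supported_sqr : \sum_(k < M) y k ^+ 2 = \sum_(i < m) c i ^+ 2.
Proof.
under eq_bigr do rewrite expr2.
rewrite sum_supported; apply: eq_bigr => i _; rewrite expr2; congr (_ * _).
rewrite /y (bigD1 i)//= eqxx mul1r big1 ?addr0// => k.
by rewrite -val_eqE/= (inj_eq sigma_inj) eq_sym => /negbTE ->; rewrite mul0r.
Qed.

End sum_supported.

Lemma dyadic_area_index_lt n t l q : (l < 2 ^ n)%N -> (q < 2 ^ t)%N ->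
  ((l * 2 ^ t + q).*2.+1 < 2 ^ (n + t).+1)%N.
Proof.
move=> ln qt; rewrite expnS mul2n ltn_Sdouble expnD.
by apply: leq_trans (_ : l.+1 * 2 ^ t <= _)%N;
  [rewrite mulSn addnC ltn_add2r|rewrite leq_mul2r ln orbT].
Qed.

(** * Areas of two independent fractional Brownian motions *)

Section area_ae.
Context {R : realType} d (Omega : measurableType d) (P : probability Omega R).
Variables (T H H' h h' : R) (X Y : R -> {RV P >-> R}).
Hypotheses (T_gt0 : 0 < T) (H01 : 0 < H < 1) (H'01 : 0 < H' < 1).
Hypotheses (hH : 0 < h <= H) (hH' : h <= H') (h12 : h <= 1 / 2) (h'h : h' < h).
Hypotheses (X_fbm : is_fbm `[0, T] H X) (Y_fbm : is_fbm `[0, T] H' Y).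
Hypothesis indep : forall A B, generated_sigma `[0, T] X A ->
  generated_sigma `[0, T] Y B -> P (A `&` B) = (P A * P B)%E.

Let gen (Z : R -> {RV P >-> R}) : set (set Omega) :=
  [set E | exists k, `[0, T]%classic k /\ exists A : set R,
         measurable A /\ E = Z k @^-1` A].

Let gen_measurable Z : gen Z `<=` measurable.
Proof.
move=> _ [k [_ [A [mA ->]]]]; rewrite -[_ @^-1` _]setTI.
exact: measurable_funP.
Qed.

Let measurable_gen Z t : `[0, T]%classic t ->
  measurable_fun [set: g_sigma_algebraType (gen Z)] (Z t : Omega -> R).
Proof.
move=> It _ A mA; rewrite setTI; apply: sub_sigma_algebra.
by exists t; split => //; exists A.
Qed.

Let grid r k : (k <= 2 ^ r)%N -> `[0, T]%classic (dyadic_time T r k).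
Proof.
move=> kr /=; rewrite in_itv/= /dyadic_time !mulr_ge0 ?invr_ge0 ?exprn_ge0 ?(ltW T_gt0)//=.
by rewrite ger_pMl// ler_pdivrMr ?exprn_gt0// mul1r -natrX ler_nat.
Qed.

Let measurable_inc_gen Z r k : (k < 2 ^ r)%N ->
  measurable_fun [set: g_sigma_algebraType (gen Z)]
    (fun w => dyadic_increment T (Z^~ w) r k).
Proof.
move=> kr; apply: measurable_funB; apply: measurable_gen; apply: grid => //.
exact: ltnW.
Qed.

(** Tonelli's theorem integrates over the first process with the second one frozen, leaving the q-th
    power of the sum of squared frozen increments; [sum_expr_le] and the moments of single
    increments finish. The last factor 2^t is the loss in [sum_expr_le]. *)
Lemma dyadic_area_moment (q : nat) : (0 < q)%N ->
  exists2 C : R, 0 <= C & forall n t l, (l < 2 ^ n)%N ->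
  (\int[P]_w (dyadic_area T (X^~ w) (Y^~ w) n t l ^+ q.*2)%:E <=
   (C * ((2 `^ (- h)) ^+ (n + t) ^+ 4 * 2 ^+ t) ^+ q * 2 ^+ t)%:E)%E.
Proof.
move=> q0.
have [C C0 HC] := dyadic_increment_comb_moment T_gt0 H01 X_fbm q hH h12.
have [C' C'0 HC'] := dyadic_increment_moment T_gt0 H'01 Y_fbm q.
exists (C * C'); first exact: mulr_ge0.
move=> n t l ln; set r := (n + t).+1; set L := (2 ^ t)%N.
pose sg i := (l * L + i).*2.
have sg_inj : injective sg by move=> i j /double_inj /addnI.
have sg_lt i : (i < L)%N -> (sg i < 2 ^ r)%N.
  by move=> iL; apply: leq_trans (dyadic_area_index_lt ln iL); exact: leqnSn.
have sgS_lt i : (i < L)%N -> ((sg i).+1 < 2 ^ r)%N by exact: dyadic_area_index_lt.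
pose dx (w : Omega) i := dyadic_increment T (X^~ w) r (sg i).
pose dy (w : Omega) i := dyadic_increment T (Y^~ w) r (sg i).+1.
pose hh w w' := (\sum_(i < L) dx w i * dy w' i) ^+ q.*2.
have hh0 w w' : 0 <= hh w w' by rewrite /hh -mul2n exprM exprn_ge0// sqr_ge0.
rewrite (_ : (\int[P]_w _)%E = \int[P]_w (hh w w)%:E)%E//.
rewrite (independent_tonelli (@gen_measurable X) (@gen_measurable Y) indep _ hh0); last first.
  apply: measurable_funX; apply: measurable_sum => i; apply: measurable_funM.
    have mX := @measurable_inc_gen X _ _ (sg_lt _ (ltn_ord i)).
    exact: (measurableT_comp mX measurable_fst).
  have mY := @measurable_inc_gen Y _ _ (sgS_lt _ (ltn_ord i)).
  exact: (measurableT_comp mY measurable_snd).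
set b := (2 `^ (- h)) ^+ r.
have inner w' : (\int[P]_w (hh w w')%:E <=
    (C * (b ^+ 2 * \sum_(i < L) dy w' i ^+ 2) ^+ q)%:E)%E.
  have := HC r (fun k => \sum_(i < L) (k == sg i)%:R * dy w' i).
  rewrite sum_supported_sqr//.
  under eq_integral do rewrite (sum_supported _ sg_lt).
  rewrite (_ : (\int[P]_w _)%E = \int[P]_w (hh w w')%:E)%E//.
  apply: eq_integral => w _; rewrite /hh; congr ((_ ^+ _)%:E).
  by apply: eq_bigr => i _; rewrite mulrC.
have b0 : 0 <= b by rewrite exprn_ge0// powR_ge0.
have mdy i : (i < L)%N -> (\int[P]_w (dy w i ^+ q.*2)%:E <= (C' * b ^+ q.*2)%:E)%E.
  move=> iL; apply: le_trans (HC' r _ (sgS_lt _ iL)) _.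
  rewrite lee_fin ler_wpM2l// lerXn2r ?nnegrE// ?exprn_ge0 ?powR_ge0//.
  rewrite lerXn2r ?nnegrE ?powR_ge0// ler_powR ?ler1n// lerN2//.
have mdyf i : measurable_fun setT (fun w => dy w i) by exact: measurable_dyadic_increment.
have ev (x : R) : 0 <= x ^+ q.*2 by rewrite -mul2n exprM exprn_ge0// sqr_ge0.
apply: (@le_trans _ _ (\int[P]_w ((C * (b ^+ 2) ^+ q * L%:R ^+ q)%:E *
    \sum_(i < L) (dy w i ^+ q.*2)%:E))%E).
  apply: ge0_le_integral => //.
  - by move=> w' _; apply: integral_ge0 => w _; rewrite lee_fin.
  - have mh : measurable_fun [set: Omega * Omega] (fun z => (hh z.1 z.2)%:E).
      apply/measurable_EFinP; apply: measurable_funX; apply: measurable_sum => i.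
      apply: measurable_funM.
        exact: (measurableT_comp (measurable_dyadic_increment T X r (sg i)) measurable_fst).
      exact: (measurableT_comp (measurable_dyadic_increment T Y r (sg i).+1) measurable_snd).
    by apply: (@measurable_fun_fubini_tonelli_G _ _ _ _ _ P _ mh) => z; rewrite lee_fin.
  - apply: emeasurable_funM => //; apply: emeasurable_sum => i.
    by apply/measurable_EFinP; apply: measurable_funX.
  - move=> w' _; apply: le_trans (inner w') _.
    rewrite sumEFin -EFinM lee_fin -(mulrA (C * _)) -(mulrA C) ler_wpM2l//.
    rewrite exprMn ler_wpM2l ?exprn_ge0//.
    have := @sum_expr_le R L q (fun i => dy w' i ^+ 2) q0 (fun i => sqr_ge0 _).
    by under [X in _ <= _ * X -> _]eq_bigr do rewrite -exprM mul2n.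
have K0 : 0 <= C * (b ^+ 2) ^+ q * L%:R ^+ q.
  by rewrite mulr_ge0 ?exprn_ge0// mulr_ge0 ?exprn_ge0.
rewrite ge0_integralZl_EFin//; first last.
- by apply: emeasurable_sum => i; apply/measurable_EFinP; apply: measurable_funX.
- by move=> w _; apply: sume_ge0 => i _; rewrite lee_fin ev.
rewrite ge0_integral_sum//; first last.
- by move=> i w _; rewrite lee_fin ev.
- by move=> i; apply/measurable_EFinP; apply: measurable_funX.
apply: (@le_trans _ _ ((C * (b ^+ 2) ^+ q * L%:R ^+ q)%:E * (L%:R * (C' * b ^+ q.*2))%:E)%E).
  rewrite lee_wpmul2l// (_ : L%:R * _ = \sum_(i < L) C' * b ^+ q.*2); last first.
    by rewrite sumr_const card_ord mulr_natl.
  by rewrite -sumEFin; apply: lee_sum => i _; exact: mdy.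
rewrite -EFinM lee_fin.
have -> : C * (b ^+ 2) ^+ q * L%:R ^+ q * (L%:R * (C' * b ^+ q.*2)) =
    C * C' * (b ^+ 4 * 2 ^+ t) ^+ q * 2 ^+ t.
  rewrite /L natrX -mul2n (exprM b 2 q) (exprMn _ (b ^+ 4) (2 ^+ t)).
  rewrite (_ : (b ^+ 4) ^+ q = (b ^+ 2) ^+ q * (b ^+ 2) ^+ q); last first.
    by rewrite -exprMn -exprD.
  by move: ((b ^+ 2) ^+ q) (((2 : R) ^+ t) ^+ q) ((2 : R) ^+ t) => u v z; ring.
rewrite ler_wpM2r ?exprn_ge0// ler_wpM2l ?mulr_ge0//.
rewrite lerXn2r ?nnegrE ?mulr_ge0 ?exprn_ge0 ?powR_ge0//.
rewrite ler_wpM2r ?exprn_ge0// lerXn2r ?nnegrE ?exprn_ge0 ?powR_ge0//.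
(* The increments live on level n + t + 1; their extra factor 2^(-h) <= 1 is dropped. *)
rewrite /b exprS ler_piMl ?exprn_ge0 ?powR_ge0//.
have h0 : 0 <= h by case/andP: hH => /ltW.
by rewrite -[leRHS](powRr0 2) ler_powR ?ler1n// oppr_le0.
Qed.

Lemma dyadic_area_ae :
  {ae P, forall w, exists2 K : R, 0 <= K & forall n t l, (l < 2 ^ n)%N ->
     `|dyadic_area T (X^~ w) (Y^~ w) n t l| <=
     K * (((2 `^ (- h')) ^+ 2) ^+ n * (Num.sqrt 2 * (2 `^ (- h')) ^+ 2) ^+ t)}.
Proof.
have dh : 0 < h - h' by rewrite subr_gt0.
(* With q (h - h') >= 1, replacing h by h' gains 16^(-r) in the 2q-th moments; the trailing 2^t <=
   2^r of [dyadic_area_moment] reduces this to 8^(-r). *)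
pose q := (Num.truncn (h - h')^-1).+1.
have hq : 1 <= q%:R * (h - h').
  by rewrite -ler_pdivrMr// mul1r ltW// /q; exact: truncnS_gt.
have [C C0 HC] := @dyadic_area_moment q isT.
set b' := 2 `^ (- h'); have b'0 : 0 < b' by rewrite powR_gt0.
(* The triples (n, t, l) are grouped by r = n + t, and indices l >= 2^n are padded with the zero
   variable. As r + 1 <= 2^r there are at most 4^r of them, against 8^(-r). *)
pose J r : finType := ('I_r.+1 * 'I_(2 ^ r))%type.
pose Z r (j : J r) w : R := if (j.2 < 2 ^ j.1)%N then
   dyadic_area T (X^~ w) (Y^~ w) j.1 (r - j.1) j.2 else 0.
pose s r (j : J r) : R := (b' ^+ 2) ^+ j.1 * (Num.sqrt 2 * b' ^+ 2) ^+ (r - j.1).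
have s0 r (j : J r) : 0 < s r j.
  by rewrite /s mulr_gt0 ?exprn_gt0// mulr_gt0 ?exprn_gt0// sqrtr_gt0.
have mZ r (j : J r) : measurable_fun setT (Z r j).
  case jl: (j.2 < 2 ^ j.1)%N; rewrite /Z jl//; apply: measurable_sum => i.
  by apply: measurable_funM; exact: measurable_dyadic_increment.
have card r : #|J r|%:R * (C * 8 ^- r) <= C / 2 ^+ r.
  rewrite card_prod !card_ord natrM natrX mulrCA ler_wpM2l//.
  rewrite (_ : 8 = 2 * 2 * 2 :> R); last by ring.
  have p0 : 2 ^+ r != 0 :> R by rewrite expf_neq0.
  have -> : (2 * 2 * 2) ^+ r = 2 ^+ r * 2 ^+ r * 2 ^+ r :> R by rewrite !exprMn.
  have -> : r.+1%:R * 2 ^+ r * (2 ^+ r * 2 ^+ r * 2 ^+ r)^-1 =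
     (r.+1%:R / 2 ^+ r) * (2 ^+ r)^-1 :> R by field.
  rewrite ler_piMl ?invr_ge0 ?exprn_ge0// ler_pdivrMr ?exprn_gt0// mul1r.
  by rewrite -natrX ler_nat ltn_expl.
have mom r (j : J r) : (\int[P]_w (Z r j w ^+ q.*2)%:E <=
    ((C * 8 ^- r) * s r j ^+ q.*2)%:E)%E.
  case jl: (j.2 < 2 ^ j.1)%N; rewrite /Z jl; last first.
    rewrite (eq_integral (fun=> 0%E)) ?integral0 ?lee_fin; last first.
      by move=> w _; rewrite expr0n double_eq0.
    by rewrite mulr_ge0 ?exprn_ge0 ?(ltW (s0 _ _))// mulr_ge0// invr_ge0 exprn_ge0.
  apply: le_trans (HC j.1 (r - j.1)%N j.2 jl) _.
  have jr : (j.1 <= r)%N by rewrite -ltnS ltn_ord.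
  rewrite subnKC// lee_fin -!(mulrA C) ler_wpM2l//.
  set t := (r - j.1)%N; set b := 2 `^ (- h).
  have sE : s r j ^+ q.*2 = ((b' ^+ r) ^+ 4 * 2 ^+ t) ^+ q.
    rewrite -mul2n exprM; congr (_ ^+ _); rewrite /s -/t.
    rewrite (_ : b' ^+ r = b' ^+ j.1 * b' ^+ t); last by rewrite -exprD subnKC.
    have k2 : (Num.sqrt 2) ^+ t * (Num.sqrt 2) ^+ t = 2 ^+ t :> R.
      by rewrite -exprMn -expr2 sqr_sqrtr.
    have e2 (a : R) m : (a ^+ 2) ^+ m = a ^+ m * a ^+ m by rewrite expr2 exprMn.
    rewrite -k2 (exprMn _ (Num.sqrt 2)) !e2.
    by move: (b' ^+ j.1) (b' ^+ t) (Num.sqrt 2 ^+ t) => u v z; ring.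
  rewrite sE !(exprMn q _ (2 ^+ t)).
  have bq : b ^+ q <= 2^-1 * b' ^+ q by apply: (@powR2N_ratio R h h' 1).
  have bq0 : 0 <= b ^+ q by rewrite exprn_ge0// powR_ge0.
  have b4 : ((b ^+ r) ^+ 4) ^+ q <= 16 ^- r * ((b' ^+ r) ^+ 4) ^+ q.
    have e4 (a : R) : ((a ^+ r) ^+ 4) ^+ q = ((a ^+ q) ^+ 4) ^+ r.
      rewrite -(exprM _ 4 q) -(exprM a r) -(exprM _ 4 r) -(exprM a q).
      by rewrite mulnCA mulnA mulnC.
    have b4 : (b ^+ q) ^+ 4 <= 16^-1 * (b' ^+ q) ^+ 4.
      have -> : 16^-1 * (b' ^+ q) ^+ 4 = (2^-1 * b' ^+ q) ^+ 4 by field.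
      by rewrite lerXn2r ?nnegrE// (le_trans bq0).
    have n0 : 0 <= (b ^+ q) ^+ 4 by rewrite exprn_ge0.
    rewrite !e4 -exprVn -exprMn lerXn2r ?nnegrE//.
    exact: le_trans n0 b4.
  have t2 : 2 ^+ t <= 2 ^+ r :> R by rewrite ler_eXn2l ?ltr1n// leq_subr.
  have e8 : 8 ^- r = 16 ^- r * 2 ^+ r :> R.
    have p0 : 2 ^+ r != 0 :> R by rewrite expf_neq0.
    have p1 : 8 ^+ r != 0 :> R by rewrite expf_neq0.
    have -> : 16 ^+ r = 8 ^+ r * 2 ^+ r :> R by rewrite -exprMn; congr (_ ^+ _); ring.
    by rewrite invfM mulfVK.
  set B := ((b' ^+ r) ^+ 4) ^+ q in b4 *; set U := (2 ^+ t) ^+ q.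
  have -> : 8 ^- r * (B * U) = (16 ^- r * B) * U * 2 ^+ r by rewrite e8; ring.
  have U0 : 0 <= U by rewrite exprn_ge0// exprn_ge0.
  have L0 : 0 <= ((b ^+ r) ^+ 4) ^+ q * U.
    by rewrite mulr_ge0// !exprn_ge0// powR_ge0.
  by apply: ler_pM => //; rewrite ler_wpM2r.
have := @ae_bounded_of_moments R d Omega P J Z s _ C q isT C0 mZ s0 card mom.
apply: filterS => w [K K0 HK]; exists K => // n t l ln.
have nr : (n < (n + t).+1)%N by rewrite ltnS leq_addr.
have lr : (l < 2 ^ (n + t))%N by apply: leq_trans ln _; rewrite leq_exp2l// leq_addr.
have := HK (n + t)%N (Ordinal nr, Ordinal lr).
by rewrite /Z /s/= ln addKn.
Qed.

End area_ae.

(** * Chaining *)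

Section chaining.
Context {R : realType}.

(* A nearly subadditive interval function is controlled by its values on dyadic
   intervals: every interval is exhausted, from a dyadic point inside it, by
   dyadic intervals of geometrically decreasing length. *)
Section grid.
Variables (B beta : R) (M : nat) (psi : nat -> nat -> R).
Hypotheses (B_gt1 : 1 < B) (beta_ge0 : 0 <= beta).
Hypothesis psi_diag : forall a, (a <= M)%N -> psi a a <= 0.
Hypothesis psi_dyadic : forall j l, (l.+1 * 2 ^ j <= M)%N ->
  psi (l * 2 ^ j)%N (l.+1 * 2 ^ j)%N <= beta * B ^+ j.
Hypothesis psi_chen : forall a c e j, (a <= c <= e)%N -> (e <= M)%N ->
  (e - a <= 2 ^ j)%N -> psi a e <= psi a c + psi c e + beta * B ^+ j.

(** [K] is chosen so that x + K x + B x <= K B x, the step from one level to the next: K (B - 1) =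
    2B >= 1 + B. *)
Let K := 2 * B / (B - 1).

Let B1_gt0 : 0 < B - 1. Proof. by rewrite subr_gt0. Qed.

Let K_ge2 : 2 <= K.
Proof. by rewrite /K ler_pdivlMr// ler_pM2l// gerBl. Qed.

Let stepK x : 0 <= x -> x + K * x + x * B <= K * (x * B).
Proof.
move=> x0; have -> : K * (x * B) = K * x + 2 * B * x.
  by rewrite /K; field; rewrite gt_eqF.
by have := ler_wpM2r x0 (ltW B_gt1); lra.
Qed.

Let K_mono j : K * (beta * B ^+ j) <= K * (beta * B ^+ j.+1).
Proof.
rewrite ler_wpM2l ?(le_trans _ K_ge2)// ler_wpM2l// ler_eXn2l//.
Qed.

Let bB_ge0 j : 0 <= beta * B ^+ j.
Proof. by rewrite mulr_ge0// exprn_ge0// (le_trans _ (ltW B_gt1)). Qed.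

(** If c lies beyond the midpoint of the block, split off the left half and recurse in the right
    one; otherwise recurse in the left half. *)
Let from_left j l c : (l * 2 ^ j <= c <= l.+1 * 2 ^ j)%N -> (c <= M)%N ->
  psi (l * 2 ^ j)%N c <= K * (beta * B ^+ j).
Proof.
elim: j l c => [|j IHj] l c /andP[lc cl] cM.
  have K0 : 0 <= K * (beta * B ^+ 0) by rewrite mulr_ge0 ?(le_trans _ K_ge2).
  move: lc cl; rewrite expn0 !muln1 => lc cl.
  have [->|cl'] := eqVneq c l; first by apply: (le_trans (psi_diag _)) => //; lia.
  have -> : c = l.+1 by lia.
  have := @psi_dyadic 0 l; rewrite expn0 !muln1 => /(_ _)/le_trans; apply; first by lia.
  by rewrite ler_peMl ?bB_ge0// (le_trans _ K_ge2)// ler1n.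
have e2 : (2 ^ j.+1 = 2 ^ j + 2 ^ j)%N by rewrite expnS mul2n addnn.
have ll : (l * 2 ^ j.+1 = l.*2 * 2 ^ j)%N by rewrite expnS mulnA -muln2.
have [cm|cm] := leqP c (l.*2.+1 * 2 ^ j).
  by rewrite ll; apply: le_trans (IHj _ _ _ cM) (K_mono j); rewrite -ll lc.
rewrite ll; apply: (le_trans (psi_chen (c := (l.*2.+1 * 2 ^ j)%N) (j := j.+1) _ _ _)) => //.
- by rewrite leq_mul2r leqnSn orbT (ltnW cm).
- by move: lc cl; rewrite e2 !mulSn !mulnDr -!addnn; lia.
rewrite exprSr mulrA; apply: le_trans (stepK (bB_ge0 j)); rewrite lerD// lerD//.
  by apply: psi_dyadic; rewrite (leq_trans (ltnW cm)).
apply: IHj => //; rewrite (ltnW cm)/=; move: cl.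
by rewrite e2 !mulSn mulnDr -addnn mulnDl; lia.
Qed.

Let from_right j l c : (l * 2 ^ j <= c <= l.+1 * 2 ^ j)%N -> (l.+1 * 2 ^ j <= M)%N ->
  psi c (l.+1 * 2 ^ j)%N <= K * (beta * B ^+ j).
Proof.
elim: j l c => [|j IHj] l c /andP[lc cl] lM.
  have K0 : 0 <= K * (beta * B ^+ 0) by rewrite mulr_ge0 ?(le_trans _ K_ge2).
  move: lc cl lM; rewrite expn0 !muln1 => lc cl lM.
  have [->|cl'] := eqVneq c l.+1; first by apply: (le_trans (psi_diag _)).
  have -> : c = l by lia.
  have := @psi_dyadic 0 l; rewrite expn0 !muln1 => /(_ lM)/le_trans; apply.
  by rewrite ler_peMl ?bB_ge0// (le_trans _ K_ge2)// ler1n.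
have e2 : (2 ^ j.+1 = 2 ^ j + 2 ^ j)%N by rewrite expnS mul2n addnn.
have ll : (l.+1 * 2 ^ j.+1 = l.*2.+1.+1 * 2 ^ j)%N by rewrite expnS mulnA muln2 doubleS.
have [cm|cm] := leqP (l.*2.+1 * 2 ^ j) c.
  rewrite ll; apply: le_trans (IHj _ _ _ _) (K_mono j); last by rewrite -ll.
  by rewrite cm -ll.
rewrite ll; apply: (le_trans (psi_chen (c := (l.*2.+1 * 2 ^ j)%N) (j := j.+1) _ _ _)).
- by rewrite (ltnW cm)/= leq_mul2r leqnSn orbT.
- by rewrite -ll.
- by move: lc cl; rewrite e2 !mulSn !mulnDr -!addnn mulnDl; lia.
rewrite exprSr mulrA; apply: le_trans (stepK (bB_ge0 j)); rewrite lerD// addrC lerD//.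
  by apply: psi_dyadic; rewrite -ll.
apply: IHj => //.
  by rewrite (ltnW cm) andbT; move: lc; rewrite e2 mulnDr -addnn mulnDl; lia.
by rewrite (leq_trans _ lM)// ll leq_mul2r leqnSn orbT.
Qed.

Lemma grid_chaining j a c : (a <= c <= M)%N -> (c - a <= 2 ^ j)%N ->
  psi a c <= (2 * K + 3) * (beta * B ^+ j).
Proof.
have K0 : 0 <= K by rewrite (le_trans _ K_ge2).
elim: j a c => [|j IHj] a c /andP[ac cM] ca.
  apply: (@le_trans _ _ (K * (beta * B ^+ 0))); last first.
    by rewrite ler_wpM2r//; lra.
  by have := @from_left 0 a c; rewrite expn0 !muln1; apply => //; move: ca; rewrite expn0; lia.
have mono : beta * B ^+ j <= beta * B ^+ j.+1 by rewrite ler_wpM2l// ler_eXn2l.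
have [ca'|ca'] := leqP (c - a) (2 ^ j).
  apply: (le_trans (IHj a c _ ca')); first by rewrite ac.
  by rewrite ler_wpM2l// addr_ge0// mulr_ge0.
have e2 : (2 ^ j.+1 = 2 ^ j + 2 ^ j)%N by rewrite expnS mul2n addnn.
(* [p] is the first multiple of 2^j after a. From p to c there is at most one full block and a
   remainder, so 2K + 3 counts two partial blocks, one full block and two splitting errors. *)
set l := (a %/ 2 ^ j)%N; have p0 : (0 < 2 ^ j)%N by rewrite expn_gt0.
have la : (l * 2 ^ j <= a)%N by exact: leq_divM.
have al : (a < l.+1 * 2 ^ j)%N by exact: ltn_ceil.
set p := (l.+1 * 2 ^ j)%N in al *.
have pa : (p - a <= 2 ^ j)%N by rewrite /p mulSn; lia.
have pc : (p <= c)%N by lia.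
apply: (le_trans (psi_chen (c := p) (j := j.+1) _ _ _)) => //; first by rewrite (ltnW al).
have h1 : psi a p <= K * (beta * B ^+ j).
  by apply: from_right; [rewrite la ltnW|rewrite (leq_trans pc)].
have h2 : psi p c <= beta * B ^+ j + K * (beta * B ^+ j) + beta * B ^+ j.+1.
  have [cq|cq] := leqP c (l.+2 * 2 ^ j).
    apply: (@le_trans _ _ (K * (beta * B ^+ j))).
      by apply: from_left => //; rewrite pc.
    by have := bB_ge0 j; have := bB_ge0 j.+1; lra.
  apply: (le_trans (psi_chen (c := (l.+2 * 2 ^ j)%N) (j := j.+1) _ _ _)) => //.
  - by rewrite (ltnW cq) andbT /p leq_mul2r leqnSn orbT.
  - by apply: leq_trans ca; lia.
  rewrite lerD// lerD//; first by apply: psi_dyadic; rewrite (leq_trans (ltnW cq)).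
  by apply: from_left => //; rewrite (ltnW cq)/=; move: ca; rewrite e2 !mulSn -/p; lia.
have := ler_wpM2l K0 mono.
move: (psi a p) (psi p c) (beta * B ^+ j) (beta * B ^+ j.+1) h1 h2 mono.
by move: (K) => k u v x y; lra.
Qed.

End grid.
Lemma powR_expX (x theta : R) j : 0 <= x -> (x ^+ j) `^ theta = (x `^ theta) ^+ j.
Proof.
move=> x0; rewrite -(powR_mulrn j (powR_ge0 x theta)) -(powR_mulrn j x0).
by rewrite -!powRrM mulrC.
Qed.

(** The grid constant 2K + 3 with B = 2^theta; one more factor 2^theta rounds the length up to a
    power of 2, and 4 counts the two partial end cells and two splitting errors. *)
Definition chaining_const (theta : R) : R :=
  (2 * (2 * 2 `^ theta / (2 `^ theta - 1)) + 3) * 2 `^ theta + 4.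

Lemma powR2_gt1 (theta : R) : 0 < theta -> 1 < 2 `^ theta.
Proof. by move=> th0; rewrite /powR pnatr_eq0/= expR_gt1 mulr_gt0// ln_gt0 ?ltr1n. Qed.

Lemma chaining_const_ge0 (theta : R) : 0 < theta -> 0 <= chaining_const theta.
Proof.
move=> /powR2_gt1 B1; rewrite /chaining_const addr_ge0// mulr_ge0 ?powR_ge0//.
by rewrite addr_ge0// mulr_ge0// divr_ge0 ?subr_ge0 ?(ltW B1)// mulr_ge0// powR_ge0.
Qed.

Lemma interval_chaining (theta beta : R) (M : nat) (psi : R -> R -> R) :
  0 < theta -> 0 <= beta -> (0 < M)%N ->
  (forall a u v, (a < M)%N -> a%:R <= u -> u <= v -> v <= a.+1%:R ->
     psi u v <= beta * (v - u) `^ theta) ->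
  (forall j l, (l.+1 * 2 ^ j <= M)%N ->
     psi (l * 2 ^ j)%:R (l.+1 * 2 ^ j)%:R <= beta * (2 `^ theta) ^+ j) ->
  (forall u v w, 0 <= u -> u <= v -> v <= w -> w <= M%:R ->
     psi u w <= psi u v + psi v w + beta * (w - u) `^ theta) ->
  forall u v, 0 <= u -> u <= v -> v <= M%:R ->
    psi u v <= chaining_const theta * (beta * (v - u) `^ theta).
Proof.
move=> th0 b0 M0 cell dyad chen u v u0 uv vM.
set B := 2 `^ theta.
have B1 : 1 < B by exact: powR2_gt1.
have mono x y : 0 <= x -> x <= y -> beta * x `^ theta <= beta * y `^ theta.
  move=> x0 xy; have y0 := le_trans x0 xy.
  by rewrite ler_wpM2l// ge0_ler_powR ?nnegrE ?(ltW th0).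
have th_neq0 : theta != 0 by rewrite gt_eqF.
have diag (a : nat) : (a <= M)%N -> psi a%:R a%:R <= 0.
  move=> aM; apply: (@le_trans _ _ (beta * (a%:R - a%:R) `^ theta)).
    have [->|neq] := eqVneq a M.
      have -> : M = M.-1.+1 by rewrite prednK.
      by apply: (cell M.-1); rewrite ?ler_nat ?leqnSn// prednK.
    have aM' : (a < M)%N by rewrite ltn_neqAle neq.
    by apply: (cell a) => //; rewrite ler_nat.
  by rewrite subrr powR0// mulr0.
have grid_bound (a c : nat) : (a <= c <= M)%N ->
    psi a%:R c%:R <= (2 * (2 * B / (B - 1)) + 3) * B * (beta * (c%:R - a%:R) `^ theta).
  move=> /andP[ac cM].
  have K0 : 0 <= (2 * (2 * B / (B - 1)) + 3).
    by rewrite addr_ge0// mulr_ge0// divr_ge0 ?subr_ge0 ?(ltW B1)// mulr_ge0// powR_ge0.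
  have [->|neq] := eqVneq a c.
    apply: (le_trans (diag _ cM)); rewrite mulr_ge0//.
      by rewrite mulr_ge0// powR_ge0.
    by rewrite mulr_ge0// powR_ge0.
  set n := (c - a)%N; have n0 : (0 < n)%N by rewrite /n; lia.
  (* 2^j <= n < 2^(j+1), so the bound at level j + 1 exceeds the one for the true length by at most
     a factor 2^theta. *)
  have hn := trunc_log_bounds (ltnSn 1) n0; set j := trunc_log 2 n in hn.
  move: hn => /andP[jn nj].
  have := @grid_chaining B beta M (fun a c => psi a%:R c%:R) B1 b0 diag dyad _ j.+1 a c.
  move=> /(_ _ _ (ltnW nj))/le_trans; apply; rewrite ?ac//.
    move=> a' c' e' i /andP[ac' ce'] eM ei; apply: (le_trans (chen _ c'%:R _ _ _ _ _));
      rewrite ?ler_nat//.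
    rewrite lerD2l -powR_expX//; apply: mono.
      by rewrite subr_ge0 ler_nat (leq_trans ac').
    by rewrite -natrB ?(leq_trans ac')// -natrX ler_nat.
  rewrite -[leRHS]mulrA ler_wpM2l// exprS mulrCA ler_wpM2l ?powR_ge0//.
  rewrite -powR_expX//; apply: mono; first exact: exprn_ge0.
  by rewrite -natrB// -natrX ler_nat.
have cell' (a : nat) w : (a <= M)%N -> a%:R <= w -> w <= a.+1%:R -> w <= M%:R ->
    psi a%:R w <= beta * (w - a%:R) `^ theta.
  move=> aM aw wa wM; have [aM'|] := ltnP a M; first exact: (cell a).
  move=> Ma; have aE : a = M by apply/eqP; rewrite eqn_leq aM Ma.
  have wE : w = a%:R by apply/eqP; rewrite eq_le aw aE wM.
  by rewrite wE subrr powR0// mulr0 diag.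
set a := Num.truncn u; set c := Num.truncn v.
have v0 := le_trans u0 uv.
have /andP[au ua] : a%:R <= u < a.+1%:R by rewrite truncn_itv.
have /andP[cv vc] : c%:R <= v < c.+1%:R by rewrite truncn_itv.
have C4 : 1 <= chaining_const theta.
  rewrite /chaining_const -/B -[leLHS]add0r lerD ?ler1n//.
  rewrite mulr_ge0 ?powR_ge0// addr_ge0// mulr_ge0// divr_ge0 ?subr_ge0 ?(ltW B1)//.
  by rewrite mulr_ge0// powR_ge0.
have P0 : 0 <= beta * (v - u) `^ theta by rewrite mulr_ge0// powR_ge0.
have aM : (a <= M)%N by rewrite -(ler_nat R) (le_trans au)// (le_trans uv).
have cM : (c <= M)%N by rewrite -(ler_nat R) (le_trans cv).
have [va|av] := leP v a.+1%:R.
  apply: (@le_trans _ _ (beta * (v - u) `^ theta)); last by rewrite ler_peMl.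
  have [aM'|Ma] := ltnP a M; first exact: (cell a).
  have aE : a = M by apply/eqP; rewrite eqn_leq aM Ma.
  have uE : u = a%:R by apply/eqP; rewrite eq_le au andbT aE (le_trans uv).
  by have := cell' a v aM (le_trans au uv) va vM; rewrite -uE.
have ac : (a.+1 <= c)%N by rewrite -ltnS -(ltr_nat R) (lt_trans av).
have a1c : a.+1%:R <= c%:R :> R by rewrite ler_nat.
have aM' : (a < M)%N by rewrite (leq_trans ac).
have h1 := cell a u a.+1%:R aM' au (ltW ua) (lexx _).
have h3 := cell' c v cM cv (ltW vc) vM.
have h2 := @grid_bound a.+1 c; rewrite ac cM in h2; have {}h2 := h2 isT.
have k1 := chen u a.+1%:R v u0 (ltW ua) (ltW av) vM.
have k2 := chen a.+1%:R c%:R v (ler0n _ _) a1c cv vM.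
have m1 : beta * (a.+1%:R - u) `^ theta <= beta * (v - u) `^ theta.
  by apply: mono; [rewrite subr_ge0 ltW|rewrite lerD2r ltW].
have m3 : beta * (v - c%:R) `^ theta <= beta * (v - u) `^ theta.
  by apply: mono; [rewrite subr_ge0|rewrite lerD2l lerN2 (le_trans (ltW ua))].
have m4 : beta * (v - a.+1%:R) `^ theta <= beta * (v - u) `^ theta.
  by apply: mono; [rewrite subr_ge0 ltW|rewrite lerD2l lerN2 ltW].
have m2 : beta * (c%:R - a.+1%:R) `^ theta <= beta * (v - u) `^ theta.
  by apply: mono; [rewrite subr_ge0|apply: lerB => //; rewrite ltW].
have K1 : 0 <= (2 * (2 * B / (B - 1)) + 3) * B.
  rewrite mulr_ge0 ?powR_ge0// addr_ge0// mulr_ge0// divr_ge0 ?subr_ge0 ?(ltW B1)//.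
  by rewrite mulr_ge0// powR_ge0.
have := ler_wpM2l K1 m2; rewrite /chaining_const -/B.
move: ((2 * (2 * B / (B - 1)) + 3) * B) h2 => K h2 m2'.
by rewrite [leRHS]mulrDl; lra.
Qed.

End chaining.

(** * Interpolated paths *)

Section interpolation.
Context {R : realType}.
Implicit Types (X Y : nat -> R) (s u v : R).

(** Time is measured in units of the mesh, so the nodes are the integers. *)
Definition interp X s : R :=
  X (Num.truncn s) + (s - (Num.truncn s)%:R) * (X (Num.truncn s).+1 - X (Num.truncn s)).

(* A primitive of [interp X] with respect to [d (interp Y)]. *)
Definition interp_primitive X Y s : R :=
  \sum_(q < Num.truncn s) (X q + X q.+1) / 2 * (Y q.+1 - Y q) +
  (X (Num.truncn s) + interp X s) / 2 * (interp Y s - Y (Num.truncn s)).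

(** A closed form for the integral of X - X_u against dY over [u, v]. All estimates are made on it;
    the Riemann-Stieltjes integral is compared with it at the end. *)
Definition interp_area X Y u v : R :=
  interp_primitive X Y v - interp_primitive X Y u -
  interp X u * (interp Y v - interp Y u).

Lemma interp_nat X a : interp X a%:R = X a.
Proof. by rewrite /interp natrK subrr mul0r addr0. Qed.

Lemma truncn_cell a s : a%:R <= s <= a.+1%:R ->
  Num.truncn s = a \/ s = a.+1%:R.
Proof.
move=> /andP[as_ sa]; have [sa'|] := ltP s a.+1%:R.
  by left; apply/truncn_def; rewrite as_ sa'.
by move=> as'; right; apply/eqP; rewrite eq_le sa.
Qed.

Lemma interp_cell X a s : a%:R <= s <= a.+1%:R ->
  interp X s = X a + (s - a%:R) * (X a.+1 - X a).
Proof.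
case/truncn_cell => [sE|->]; first by rewrite /interp sE.
by rewrite interp_nat -natr1; ring.
Qed.

Lemma interp_primitive_nat X Y a :
  interp_primitive X Y a%:R = \sum_(q < a) (X q + X q.+1) / 2 * (Y q.+1 - Y q).
Proof. by rewrite /interp_primitive natrK !interp_nat subrr mulr0 addr0. Qed.

Lemma interp_primitive_cell X Y a s : a%:R <= s <= a.+1%:R ->
  interp_primitive X Y s = \sum_(q < a) (X q + X q.+1) / 2 * (Y q.+1 - Y q) +
    (X a + interp X s) / 2 * (interp Y s - Y a).
Proof.
case/truncn_cell => [sE|->]; first by rewrite /interp_primitive sE.
by rewrite interp_primitive_nat !interp_nat big_ord_recr.
Qed.

Lemma interp_primitive_sub X Y a u v : a%:R <= u <= a.+1%:R ->
  a%:R <= v <= a.+1%:R ->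
  interp_primitive X Y v - interp_primitive X Y u =
    (interp X u + interp X v) / 2 * (interp Y v - interp Y u).
Proof.
move=> ua va; rewrite (interp_primitive_cell X Y ua) (interp_primitive_cell X Y va).
by rewrite !(interp_cell _ ua) !(interp_cell _ va); field.
Qed.

Lemma interp_area_cell X Y a u v : a%:R <= u <= a.+1%:R -> a%:R <= v <= a.+1%:R ->
  interp_area X Y u v =
    (interp X v - interp X u) * (interp Y v - interp Y u) / 2.
Proof.
by move=> ua va; rewrite /interp_area (interp_primitive_sub X Y ua va); field.
Qed.

Lemma interp_area_chen X Y u v w : interp_area X Y u w =
  interp_area X Y u v + interp_area X Y v w +
  (interp X v - interp X u) * (interp Y w - interp Y v).
Proof. by rewrite /interp_area; ring. Qed.

(** A segment has area half the product of its increments. Cutting it in two replaces (A + A')(C +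
    C') / 2 by AC/2 + A'C'/2 + AC', a change of (AC' - A'C) / 2. By Chen's relation the changes add
    up, since values at coarse nodes are kept. *)
Lemma interp_area_refine X Y X' Y' a c :
  (forall q, X' q.*2 = X q) -> (forall q, Y' q.*2 = Y q) ->
  interp_area X' Y' a.*2%:R (a + c).*2%:R - interp_area X Y a%:R (a + c)%:R =
  (\sum_(q < c) (X' (a + q).*2.+1 - X' (a + q).*2) * (Y' (a + q).*2.+2 - Y' (a + q).*2.+1) -
   \sum_(q < c) (Y' (a + q).*2.+1 - Y' (a + q).*2) * (X' (a + q).*2.+2 - X' (a + q).*2.+1)) / 2.
Proof.
move=> XE YE; elim: c => [|c IHc].
  by rewrite !big_ord0 addn0 /interp_area !subrr !mulr0 !subr0 mul0r.
rewrite !big_ord_recr/= addnS doubleS.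
rewrite (interp_area_chen X Y _ (a + c)%:R) (interp_area_chen X' Y' _ (a + c).*2%:R).
rewrite (@interp_area_cell X Y (a + c) (a + c)%:R (a + c).+1%:R) ?lexx ?ler_nat ?leqnSn//.
rewrite (interp_area_chen X' Y' (a + c).*2%:R (a + c).*2.+1%:R).
rewrite (@interp_area_cell X' Y' (a + c).*2 (a + c).*2%:R (a + c).*2.+1%:R)
  ?lexx ?ler_nat ?leqnSn//.
rewrite (@interp_area_cell X' Y' (a + c).*2.+1 (a + c).*2.+1%:R (a + c).*2.+2%:R)
  ?lexx ?ler_nat ?leqnSn//.
rewrite !interp_nat.
have X2 := XE (a + c).+1; have Y2 := YE (a + c).+1; rewrite doubleS in X2 Y2.
rewrite !XE !YE X2 Y2.
move: IHc.
set A' := interp_area X' Y' _ _; set A := interp_area X Y _ _.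
set S1 := \sum_(i < c) _; set S2 := \sum_(i < c) _ => IHc.
have -> : A' = A + (S1 - S2) / 2 by rewrite -IHc; ring.
by field.
Qed.

Variables (T : R).

Definition level (x : R -> R) (m q : nat) : R := x (dyadic_time T m q).

Lemma level_scale x m j l : level x (m + j) (l * 2 ^ j) = level x m l.
Proof.
rewrite /level /dyadic_time natrM natrX exprD; congr (x (_ * _)).
by field; rewrite !expf_neq0.
Qed.

Lemma level_double x m q : level x m.+1 q.*2 = level x m q.
Proof. by rewrite -addn1 -muln2; exact: (level_scale x m 1). Qed.

Lemma level_sub x m q : level x m q.+1 - level x m q = dyadic_increment T x m q.
Proof. by []. Qed.

Section estimates.
Variables (h : R) (h01 : 0 < h <= 1).
Let b := 2 `^ (- h).

Let h_gt0 : 0 < h. Proof. by case/andP: h01. Qed.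

Let b_ge0 : 0 <= b. Proof. exact: powR_ge0. Qed.

Let bE m j : b ^+ m = b ^+ (m + j) * (2 `^ h) ^+ j.
Proof.
rewrite exprD -mulrA -exprMn /b -powRD ?pnatr_eq0 ?implybT//.
by rewrite addNr powRr0 expr1n mulr1.
Qed.

Let dyadic_index m j l : (l.+1 * 2 ^ j <= 2 ^ m)%N ->
  exists2 n, m = (n + j)%N & (l < 2 ^ n)%N.
Proof.
move=> lm; have jm : (j <= m)%N.
  by rewrite -(leq_exp2l j m (ltnSn 1)) (leq_trans _ lm)// mulSn leq_addr.
exists (m - j)%N; first by rewrite subnK.
by rewrite -(leq_pmul2r (_ : 0 < 2 ^ j)%N) ?expn_gt0// -expnD subnK.
Qed.

(** Increments satisfy the triangle inequality, so chaining applies with no splitting error. Inside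
    a cell, v - u <= 1 and h <= 1 turn linear growth into Hoelder growth. *)
Lemma interp_holder (x : R -> R) (K : R) : 0 <= K ->
  (forall r k, (k < 2 ^ r)%N -> `|dyadic_increment T x r k| <= K * b ^+ r) ->
  forall m u v, 0 <= u -> u <= v -> v <= (2 ^ m)%:R ->
  `|interp (level x m) v - interp (level x m) u| <=
    chaining_const h * (K * b ^+ m * (v - u) `^ h).
Proof.
move=> K0 HK m.
have KB0 : 0 <= K * b ^+ m by rewrite mulr_ge0// exprn_ge0.
pose psi u v : R := `|interp (level x m) v - interp (level x m) u|.
apply: (@interval_chaining R h (K * b ^+ m) (2 ^ m) psi) => //.
- by rewrite expn_gt0.
- move=> a u v am au uv va.
  have uc : a%:R <= u <= a.+1%:R by rewrite au (le_trans uv).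
  have vc : a%:R <= v <= a.+1%:R by rewrite va (le_trans au).
  rewrite /psi (interp_cell _ uc) (interp_cell _ vc) level_sub.
  rewrite (_ : _ - _ = (v - u) * dyadic_increment T x m a); last by ring.
  have vu0 : 0 <= v - u by rewrite subr_ge0.
  rewrite normrM (ger0_norm vu0) mulrC ler_pM ?HK//.
  have [->|vu] := eqVneq (v - u) 0; first exact: powR_ge0.
  apply: ger1_powR; last by case/andP: h01.
  by rewrite lt_def vu vu0/=; move: va au; rewrite -natr1; lra.
- move=> j l lm; have [n mE ln] := dyadic_index lm.
  by rewrite /psi !interp_nat mE !level_scale level_sub -mulrA -bE HK.
- move=> u v w u0 uv vw wm; rewrite /psi.
  rewrite (_ : interp _ w - interp _ u = (interp (level x m) v - interp (level x m) u) +
    (interp (level x m) w - interp (level x m) v)); last by ring.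
  by rewrite (le_trans (ler_normD _ _))// lerDl mulr_ge0// powR_ge0.
Qed.

Variables (x y : R -> R) (K K' kappa : R).
Hypotheses (K0 : 0 <= K) (K'0 : 0 <= K') (kappa01 : 0 <= kappa < 1).
Hypothesis x_inc : forall r k, (k < 2 ^ r)%N -> `|dyadic_increment T x r k| <= K * b ^+ r.
Hypothesis y_inc : forall r k, (k < 2 ^ r)%N -> `|dyadic_increment T y r k| <= K * b ^+ r.
Hypothesis xy_area : forall n t l, (l < 2 ^ n)%N ->
  `|dyadic_area T x y n t l - dyadic_area T y x n t l| <= K' * ((b ^+ 2) ^+ n * kappa ^+ t).

Let interp_area_dyadic n t l : (l < 2 ^ n)%N ->
  `|interp_area (level x (n + t)) (level y (n + t)) (l * 2 ^ t)%:R (l.+1 * 2 ^ t)%:R| <=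
    (K ^+ 2 + K' / (1 - kappa)) * (b ^+ 2) ^+ n.
Proof.
move=> ln; have k1 : 0 < 1 - kappa by rewrite subr_gt0; case/andP: kappa01.
have b2n : 0 <= (b ^+ 2) ^+ n by rewrite !exprn_ge0.
(* The induction carries the partial geometric sum of the refinement corrections; the limiting
   constant alone would not propagate. *)
suff : `|interp_area (level x (n + t)) (level y (n + t)) (l * 2 ^ t)%:R (l.+1 * 2 ^ t)%:R| <=
    (K ^+ 2 + K' * ((1 - kappa ^+ t) / (1 - kappa))) * (b ^+ 2) ^+ n.
  move=> /le_trans; apply; rewrite ler_wpM2r// lerD2l ler_wpM2l//.
  by rewrite -[leRHS]mul1r ler_pM2r ?invr_gt0// gerBl exprn_ge0//; case/andP: kappa01.
elim: t => [|t IHt].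
  rewrite expn0 !muln1 addn0 (@interp_area_cell _ _ l) ?lexx ?ler_nat ?leqnSn//.
  rewrite !interp_nat !level_sub subrr mul0r mulr0 addr0 normrM.
  rewrite normrM [X in _ * X <= _]ger0_norm; last by [].
  have := ler_pM (normr_ge0 _) (normr_ge0 _) (x_inc ln) (y_inc ln).
  rewrite (_ : K * b ^+ n * (K * b ^+ n) = K ^+ 2 * (b ^+ 2) ^+ n); last first.
    by rewrite -exprM mulnC exprM -exprMn expr2 mulrACA.
  have := mulr_ge0 (normr_ge0 (dyadic_increment T x n l))
                   (normr_ge0 (dyadic_increment T y n l)).
  by move: (`|_| * `|_|) => z; lra.
set A := interp_area _ _ _ _ in IHt.
rewrite addnS; set A' := interp_area _ _ _ _.
have dA : A' - A = (dyadic_area T x y n t l - dyadic_area T y x n t l) / 2.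
  have := @interp_area_refine (level x (n + t)) (level y (n + t)) (level x (n + t).+1)
    (level y (n + t).+1) (l * 2 ^ t) (2 ^ t) (level_double x _) (level_double y _).
  rewrite (_ : (l * 2 ^ t).*2 = l * 2 ^ t.+1)%N; last by rewrite expnS mulnCA mul2n.
  rewrite (_ : (l * 2 ^ t + 2 ^ t).*2 = l.+1 * 2 ^ t.+1)%N; last first.
    by rewrite -mulSnr expnS mulnCA mul2n.
  by rewrite -mulSnr.
have -> : A' = A + (dyadic_area T x y n t l - dyadic_area T y x n t l) / 2.
  by rewrite -dA; ring.
apply: (le_trans (ler_normD _ _)); rewrite normrM [X in _ + _ * X <= _]ger0_norm//.
have k0 : 0 <= kappa by case/andP: kappa01.
have half : `|dyadic_area T x y n t l - dyadic_area T y x n t l| / 2 <=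
    K' * ((b ^+ 2) ^+ n * kappa ^+ t).
  apply: le_trans (xy_area t ln).
  by rewrite ler_pdivrMr// -[leLHS]mulr1 ler_wpM2l ?ler1n.
apply: (le_trans (lerD IHt half)).
rewrite [leLHS](_ : _ = (K ^+ 2 + K' * ((1 - kappa ^+ t.+1) / (1 - kappa))) * (b ^+ 2) ^+ n)//.
by rewrite (exprSr kappa); move: (kappa ^+ t) ((b ^+ 2) ^+ n) => kt B; field; rewrite gt_eqF.
Qed.

(** The first two inner terms bound the area over dyadic intervals. The square is the product of two
    Hoelder constants, from the cross term in Chen's relation. *)
Definition area_const : R := chaining_const (2 * h) *
  (K ^+ 2 + K' / (1 - kappa) + (chaining_const h * K) ^+ 2).

(** Chaining with exponent 2h: the splitting error is the cross term of Chen's relation, a product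
    of two increments each Hoelder of exponent h. *)
Lemma interp_area_bound m u v : 0 <= u -> u <= v -> v <= (2 ^ m)%:R ->
  `|interp_area (level x m) (level y m) u v| <=
    area_const * ((b ^+ 2) ^+ m * (v - u) `^ (2 * h)).
Proof.
move=> u0 uv vm; set c := chaining_const h.
have k1 : 0 < 1 - kappa by rewrite subr_gt0; case/andP: kappa01.
have b2m : 0 <= (b ^+ 2) ^+ m by rewrite !exprn_ge0.
set G := K ^+ 2 + K' / (1 - kappa); set E := (c * K) ^+ 2.
have G0 : 0 <= G by rewrite /G addr_ge0 ?sqr_ge0// divr_ge0// ltW.
have E0 : 0 <= E by rewrite /E sqr_ge0.
have h2 : 0 < 2 * h by rewrite mulr_gt0.
have pw w : w `^ (2 * h) = w `^ h * w `^ h.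
  by rewrite (_ : 2 * h = h + h) ?powRD//;
    [rewrite (_ : h + h == 0 = false)// gt_eqF// addr_gt0|ring].
have holder2 u1 v1 u2 v2 w : 0 <= u1 -> u1 <= v1 -> v1 <= (2 ^ m)%:R ->
    0 <= u2 -> u2 <= v2 -> v2 <= (2 ^ m)%:R -> v1 - u1 <= w -> v2 - u2 <= w ->
    `|(interp (level x m) v1 - interp (level x m) u1) *
      (interp (level y m) v2 - interp (level y m) u2)| <=
    E * (b ^+ 2) ^+ m * w `^ (2 * h).
  move=> u10 uv1 v1m u20 uv2 v2m w1 w2.
  have := interp_holder K0 x_inc u10 uv1 v1m; rewrite -/c => H1.
  have := interp_holder K0 y_inc u20 uv2 v2m; rewrite -/c => H2.
  have w0 : 0 <= w by rewrite (le_trans _ w1)// subr_ge0.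
  rewrite normrM; apply: (le_trans (ler_pM (normr_ge0 _) (normr_ge0 _) H1 H2)).
  have m1 : (v1 - u1) `^ h <= w `^ h.
    by rewrite ge0_ler_powR ?nnegrE ?subr_ge0 ?(ltW h_gt0).
  have m2 : (v2 - u2) `^ h <= w `^ h.
    by rewrite ge0_ler_powR ?nnegrE ?subr_ge0 ?(ltW h_gt0).
  have := ler_pM (powR_ge0 _ _) (powR_ge0 _ _) m1 m2.
  have X0 : 0 <= E * (b ^+ 2) ^+ m by rewrite mulr_ge0.
  move=> /(ler_wpM2l X0); rewrite -pw => /(le_trans _); apply.
  rewrite /E (_ : (b ^+ 2) ^+ m = b ^+ m * b ^+ m); last by rewrite expr2 exprMn.
  move: ((v1 - u1) `^ h) ((v2 - u2) `^ h) (b ^+ m) => p q r.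
  by rewrite [leLHS](_ : _ = (c * K) ^+ 2 * (r * r) * (p * q))//; ring.
rewrite /area_const -/c -/G -/E -mulrA (mulrA (G + E)).
pose psi u v : R := `|interp_area (level x m) (level y m) u v|.
have GE0 : 0 <= (G + E) * (b ^+ 2) ^+ m by rewrite mulr_ge0// addr_ge0.
apply: (@interval_chaining R (2 * h) ((G + E) * (b ^+ 2) ^+ m) (2 ^ m) psi) => //.
- by rewrite expn_gt0.
- move=> a {u0 uv vm}u {}v am au uv va.
  have uc : a%:R <= u <= a.+1%:R by rewrite au (le_trans uv).
  have vc : a%:R <= v <= a.+1%:R by rewrite va (le_trans au).
  rewrite /psi (interp_area_cell _ _ uc vc) normrM [X in _ * X <= _]ger0_norm//.
  have u0 : 0 <= u by rewrite (le_trans _ au).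
  have vm : v <= (2 ^ m)%:R by rewrite (le_trans va)// ler_nat.
  have H1 := holder2 u v u v (v - u) u0 uv vm u0 uv vm (lexx _) (lexx _).
  rewrite ler_pdivrMr//; apply: (le_trans H1).
  have P0 : 0 <= (b ^+ 2) ^+ m * (v - u) `^ (2 * h) by rewrite mulr_ge0// powR_ge0.
  have := mulr_ge0 G0 P0; have := mulr_ge0 E0 P0; rewrite -!(mulrA _ ((b ^+ 2) ^+ m)).
  by move: (_ * _ `^ _) => P; lra.
- move=> j l lm; have [n mE ln] := dyadic_index lm.
  rewrite /psi mE; apply: (le_trans (interp_area_dyadic j ln)).
  rewrite -/G (_ : 2 `^ (2 * h) = (2 `^ h) ^+ 2); last by rewrite pw expr2.
  have e2 (a : R) k : (a ^+ 2) ^+ k = (a ^+ k) ^+ 2 by rewrite -!exprM mulnC.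
  rewrite !e2 (bE n j) (exprMn 2 (b ^+ (n + j))) mulrA ler_wpM2r ?sqr_ge0// ler_wpM2r ?sqr_ge0//.
  by rewrite lerDl.
- move=> {u0 uv vm}u {}v w u0 uv vw wm; rewrite /psi (interp_area_chen _ _ u v w).
  apply: (le_trans (ler_normD _ _)); rewrite lerD ?ler_normD//.
  have v0 := le_trans u0 uv; have vm := le_trans vw wm.
  apply: (le_trans (holder2 _ _ _ _ (w - u) u0 uv vm v0 vw wm _ _)).
  + by rewrite lerD2r.
  + by rewrite lerD2l lerN2.
  + by rewrite ler_wpM2r ?powR_ge0// ler_wpM2r// lerDr.
Qed.

End estimates.
End interpolation.

(** * Riemann-Stieltjes sums *)

Section stieltjes.
Context {R : realType}.
Variables (f g : R -> R).

(** The values of tagged sums of mesh below [delta], in a form that concatenates without index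
    arithmetic on sequences. *)
Inductive fine_sum (delta : R) : R -> R -> R -> Prop :=
| fine_sum_nil s : fine_sum delta s s 0
| fine_sum_cons s u t c v : s < u -> u - s < delta -> s <= c <= u ->
    fine_sum delta u t v -> fine_sum delta s t (f c * (g u - g s) + v).

Lemma fine_sum_cat delta s u t v v' : fine_sum delta s u v ->
  fine_sum delta u t v' -> fine_sum delta s t (v + v').
Proof.
move=> fsu; elim: fsu v' => [r v'|r x y c w rx dx cx _ IH v'] fut; first by rewrite add0r.
by rewrite -addrA; apply: fine_sum_cons => //; exact: IH.
Qed.

Lemma fine_sumP delta s t v : fine_sum delta s t v ->
  exists (D : seq R) (xi : nat -> R), [/\ itv_partition s t D,
    forall i, (i < size D)%N ->
      nth s (s :: D) i <= xi i <= nth s (s :: D) i.+1 /\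
      nth s (s :: D) i.+1 - nth s (s :: D) i < delta &
    stieltjes_sum f g s D xi = v].
Proof.
elim=> [r|r u y c w ru du cu _ [D [xi [pD tD sD]]]].
  exists [::], (fun=> r); split; [by split|by []|].
  by rewrite /stieltjes_sum big_geq.
exists (u :: D), (fun i => if i is j.+1 then xi j else c).
have nthE i : (i <= size D)%N -> nth r (u :: D) i = nth u (u :: D) i.
  by move=> iD; apply: set_nth_default.
split.
- by case: pD => p1 p2; split => //=; rewrite ru.
- case=> [_|i iD] //=.
  have := tD i iD; rewrite -nthE; last exact: ltnW.
  by rewrite -(nthE i.+1).
- rewrite /stieltjes_sum big_nat_recl//= -sD; congr (_ + _).
  apply: eq_big_nat => i /andP[_ iD].
  by rewrite -(nthE i (ltnW iD)) -(nthE i.+1 iD).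
Qed.

(* If the integral does not exist, [stieltjes_integral] is the junk value 0. *)
Lemma stieltjes_integral_le s t v :
  (forall delta, 0 < delta -> fine_sum delta s t v) ->
  `|stieltjes_integral f g s t| <= `|v|.
Proof.
move=> fine; rewrite /stieltjes_integral; case: xgetP => [w _ wint|_]; last first.
  by rewrite normr0.
(* The value [v] is attained by sums of arbitrarily small mesh, so any limit equals it. *)
suff -> : w = v by [].
apply/eqP; rewrite eq_sym -subr_eq0 -normr_le0; apply/ler_addgt0Pl => e e0.
rewrite addr0; have [delta d0 H] := wint e e0.
have [D [xi [pD tD <-]]] := fine_sumP (fine delta d0).
by apply/ltW/H.
Qed.

Variables (F : R -> R) (tau : nat -> R).
Hypothesis midpoint_sum : forall n u v, tau n <= u -> u < v -> v <= tau n.+1 ->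
  f ((u + v) / 2) * (g v - g u) = F v - F u.

(** With midpoint tags the sums are exact, so an interval can be halved until its pieces are shorter
    than [delta] without changing the total. *)
Let fine_sum_cell delta n u v : 0 < delta -> tau n <= u -> u <= v -> v <= tau n.+1 ->
  fine_sum delta u v (F v - F u).
Proof.
move=> d0; pose k := Num.truncn ((v - u) / delta).
have : v - u < 2 ^+ k.+1 * delta.
  rewrite -ltr_pdivrMr//; apply: (@lt_le_trans _ _ k.+1%:R).
    by rewrite /k truncnS_gt.
  by rewrite -natrX ler_nat ltnW// ltn_expl.
move: (k.+1) => {k} j; elim: j u v => [|j IHj] u v vu nu uv vn.
  move: uv; rewrite le_eqVlt => /predU1P[<-|uv]; first by rewrite subrr; exact: fine_sum_nil.
  rewrite -(midpoint_sum nu uv vn) -[_ * _]addr0; apply: fine_sum_cons => //.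
  - by move: vu; rewrite expr0 mul1r.
  - by apply/andP; split; lra.
  - exact: fine_sum_nil.
pose w := (u + v) / 2.
have uw : u <= w by rewrite /w; lra.
have wv : w <= v by rewrite /w; lra.
have hw : v - u < 2 * (2 ^+ j * delta) by rewrite mulrA -exprS.
rewrite (_ : F v - F u = (F w - F u) + (F v - F w)); last by ring.
apply: (@fine_sum_cat _ _ w).
  by apply: IHj => //; [rewrite /w; move: hw; lra|rewrite (le_trans wv)].
by apply: IHj => //; [rewrite /w; move: hw; lra|rewrite (le_trans nu)].
Qed.

Lemma fine_sum_cells delta n u v : 0 < delta -> tau 0 <= u -> u <= v -> v <= tau n ->
  fine_sum delta u v (F v - F u).
Proof.
move=> d0; elim: n u v => [|n IHn] u v u0 uv vn.
  have -> : v = u by apply/eqP; rewrite eq_le uv andbT (le_trans vn).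
  by rewrite subrr; exact: fine_sum_nil.
have [vn'|nv] := leP v (tau n); first exact: IHn.
have [nu|un] := leP (tau n) u; first exact: (@fine_sum_cell delta n).
rewrite (_ : F v - F u = (F (tau n) - F u) + (F v - F (tau n))); last by ring.
apply: (@fine_sum_cat _ _ (tau n)); first by apply: IHn => //; exact: ltW.
by apply: (@fine_sum_cell delta n) => //; exact: ltW.
Qed.

End stieltjes.

Lemma partition_sum_le (R : realType) (F : R -> R -> R) (C s t : R) (D : seq R) :
  itv_partition s t D ->
  (forall u v, s <= u -> u < v -> v <= t -> F u v <= C * (v - u)) ->
  partition_sum s D F <= C * (t - s).
Proof.
elim: D s => [|u D IHD] s pD HF.
  by rewrite /partition_sum big_geq// (itv_partition_nil pD) subrr mulr0.
have pD' := itv_partition_cons pD.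
have [/=/andP[su _] _] := pD.
have ut : u <= t.
  case: pD' => p /eqP <-; elim: D u p {su IHD pD HF} => //= y D IH u /andP[uy p].
  exact: le_trans (ltW uy) (IH _ p).
have nthE i : (i <= size D)%N -> nth s (u :: D) i = nth u (u :: D) i.
  by move=> iD; apply: set_nth_default.
rewrite /partition_sum big_nat_recl//= (_ : t - s = (u - s) + (t - u)); last by ring.
rewrite mulrDr lerD//; first exact: HF.
apply: le_trans (IHD u pD' _); last by move=> x y ux; apply: HF; rewrite (le_trans (ltW su)).
rewrite /partition_sum le_eqVlt; apply/orP; left; apply/eqP.
apply: eq_big_nat => i /andP[_ iD].
by rewrite -(nthE i (ltnW iD)) -(nthE i.+1 iD).
Qed.

(** * Hoelder bounds for the interpolated paths in real time *)

Section dyadic_paths.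
Context {R : realType}.
Variables (T : R) (d : nat).
Hypothesis T_gt0 : 0 < T.

Lemma euclid_norm_le_sum m n (A : 'M[R]_(m, n)) :
  euclid_norm A <= \sum_i \sum_j `|A i j|.
Proof.
have sum_sqr (I : finType) (f : I -> R) : (forall i, 0 <= f i) ->
    \sum_i f i ^+ 2 <= (\sum_i f i) ^+ 2.
  move=> f0; rewrite [leRHS]expr2 mulr_suml; apply: ler_sum => i _.
  by rewrite expr2 ler_wpM2l// (bigD1 i)//= lerDl sumr_ge0.
have S0 : 0 <= \sum_i \sum_j `|A i j| by do 2 (apply: sumr_ge0 => ? _).
rewrite /euclid_norm -[leRHS]ger0_norm// -sqrtr_sqr ler_wsqrtr//.
apply: le_trans (sum_sqr _ (fun i => \sum_j `|A i j|) _); last first.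
  by move=> i; apply: sumr_ge0.
apply: ler_sum => i _; apply: le_trans (sum_sqr _ (fun j => `|A i j|) _) => //.
by apply: ler_sum => j _; rewrite real_normK ?num_real.
Qed.

Let tau m t : R := t / T * 2 ^+ m.

Let T_neq0 : T != 0. Proof. by rewrite gt_eqF. Qed.

Let two_neq0 m : 2 ^+ m != 0 :> R. Proof. by rewrite expf_neq0. Qed.

Lemma dyadic_path_interp m (x : R -> 'rV[R]_d) t i :
  dyadic_path T m x t 0 i = interp (level T (fun s => x s 0 i) m) (t / T * 2 ^+ m).
Proof.
rewrite /dyadic_path /interp /level !mxE; set l := Num.truncn _.
congr (_ + _ * _).
by rewrite /dyadic_time -[l.+1%:R]natr1; field; rewrite two_neq0 T_neq0.
Qed.

Let tau_dyadic m n : tau m (dyadic_time T m n) = n%:R.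
Proof. by rewrite /tau /dyadic_time; field; rewrite two_neq0 T_neq0. Qed.

Let tau_le m s t : s <= t -> tau m s <= tau m t.
Proof. by move=> st; rewrite /tau ler_wpM2r ?exprn_ge0// ler_wpM2r// invr_ge0 ltW. Qed.

(** Both integrand and integrator are affine on each cell, where the midpoint rule is exact; [F] is
    the primitive corrected for the starting value of the integrand. *)
Lemma iterated_integral2_dyadic_le m (x : R -> 'rV[R]_d) i j u v :
  0 <= u -> u <= v -> v <= T ->
  `|iterated_integral2 (dyadic_path T m x) u v i j| <=
  `|interp_area (level T (fun s => x s 0 i) m) (level T (fun s => x s 0 j) m)
     (u / T * 2 ^+ m) (v / T * 2 ^+ m)|.
Proof.
move=> u0 uv vT; rewrite mxE.
set X := level T _ m; set Y := level T (fun s => x s 0 j) m.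
pose F t := interp_primitive X Y (tau m t) - interp X (tau m u) * interp Y (tau m t).
have -> : interp_area X Y (u / T * 2 ^+ m) (v / T * 2 ^+ m) = F v - F u.
  by rewrite /interp_area /F /tau; ring.
apply: stieltjes_integral_le => delta d0.
apply: (@fine_sum_cells _ _ _ F (dyadic_time T m) _ _ (2 ^ m)) => //; last 2 first.
- by rewrite /dyadic_time !mul0r.
- rewrite /dyadic_time natrX divff ?mul1r//.
move=> n p q np pq qn; rewrite !dyadic_path_interp -/X -/Y -!/(tau m _).
have pc : n%:R <= tau m p <= n.+1%:R.
  by rewrite -!(tau_dyadic m) !tau_le// (le_trans (ltW pq)).
have qc : n%:R <= tau m q <= n.+1%:R.
  by rewrite -!(tau_dyadic m) !tau_le// (le_trans np (ltW pq)).
have mE : tau m ((p + q) / 2) = (tau m p + tau m q) / 2 by rewrite /tau; field.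
have mc : n%:R <= tau m ((p + q) / 2) <= n.+1%:R.
  rewrite mE; move: pc qc => /andP[? ?] /andP[? ?]; apply/andP; split; lra.
rewrite /F (_ : _ - _ - (_ - _) = interp_primitive X Y (tau m q) -
  interp_primitive X Y (tau m p) - interp X (tau m u) *
  (interp Y (tau m q) - interp Y (tau m p))); last by ring.
rewrite (interp_primitive_sub X Y pc qc).
rewrite (interp_cell X mc) (interp_cell X pc) (interp_cell X qc) mE.
by move: (interp X (tau m u)) (interp Y _) (interp Y _) => *; field.
Qed.

Variables (h K K' kappa : R) (x : R -> 'rV[R]_d).
Hypotheses (h01 : 0 < h <= 1) (K0 : 0 <= K) (K'0 : 0 <= K') (kappa01 : 0 <= kappa < 1).
Hypothesis x_inc : forall i r k, (k < 2 ^ r)%N ->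
  `|dyadic_increment T (fun s => x s 0 i) r k| <= K * (2 `^ (- h)) ^+ r.
Hypothesis x_area : forall i j, i != j -> forall n t l, (l < 2 ^ n)%N ->
  `|dyadic_area T (fun s => x s 0 i) (fun s => x s 0 j) n t l| <=
  K' * (((2 `^ (- h)) ^+ 2) ^+ n * kappa ^+ t).

(** The factor 2^(-am) of level m cancels the rescaling of time by 2^m, which makes the constants
    uniform in m. *)
Let unscale m a w : 0 <= w -> (2 `^ (- a)) ^+ m * (w / T * 2 ^+ m) `^ a = (w / T) `^ a.
Proof.
move=> w0; rewrite powRM ?divr_ge0 ?exprn_ge0 ?(ltW T_gt0)// powR_expX//.
rewrite mulrCA -exprMn -powRD ?pnatr_eq0 ?implybT//.
by rewrite addNr powRr0 expr1n mulr1.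
Qed.

Let tau_range m u v : 0 <= u -> u <= v -> v <= T ->
  [/\ 0 <= tau m u, tau m u <= tau m v & tau m v <= (2 ^ m)%:R].
Proof.
move=> u0 uv vT; split.
- by rewrite /tau mulr_ge0 ?exprn_ge0// divr_ge0// ltW.
- exact: tau_le.
- by rewrite natrX (le_trans (tau_le m vT))// /tau divff// mul1r.
Qed.

Lemma dyadic_path_holder : exists2 C : R, 0 <= C & forall m u v,
  0 <= u -> u <= v -> v <= T ->
  euclid_norm (dyadic_path T m x v - dyadic_path T m x u) <= C * (v - u) `^ h.
Proof.
have ck0 : 0 <= chaining_const h by apply: chaining_const_ge0; case/andP: h01.
exists (d%:R * (chaining_const h * K * T^-1 `^ h)).
  by rewrite !mulr_ge0 ?powR_ge0//.
move=> m u v u0 uv vT; apply: (le_trans (euclid_norm_le_sum _)).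
rewrite big_ord1 -mulrA.
have -> : d%:R * (chaining_const h * K * T^-1 `^ h * (v - u) `^ h) =
    \sum_(j < d) (chaining_const h * K * T^-1 `^ h * (v - u) `^ h).
  by rewrite sumr_const card_ord mulr_natl.
apply: ler_sum => j _.
have subE (A B : 'rV[R]_d) : (A - B) 0 j = A 0 j - B 0 j by rewrite !mxE.
rewrite subE !dyadic_path_interp.
have [a1 a2 a3] := tau_range m u0 uv vT.
apply: (le_trans (interp_holder h01 K0 (x_inc j) a1 a2 a3)).
rewrite (_ : tau m v - tau m u = (v - u) / T * 2 ^+ m); last by rewrite /tau; ring.
have vu0 : 0 <= v - u by rewrite subr_ge0.
rewrite -(mulrA K) unscale// powRM// ?invr_ge0 ?(ltW T_gt0)//.
rewrite [leRHS](_ : _ = chaining_const h * (K * ((v - u) `^ h * T^-1 `^ h)))//.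
by move: (T^-1 `^ h) ((v - u) `^ h) => a1' a2'; ring.
Qed.

Lemma dyadic_path_area_holder : exists2 C : R, 0 <= C & forall m u v,
  0 <= u -> u <= v -> v <= T ->
  euclid_norm (iterated_integral2 (dyadic_path T m x) u v) <= C * (v - u) `^ (2 * h).
Proof.
have h0 : 0 < h by case/andP: h01.
have k1 : 0 < 1 - kappa by rewrite subr_gt0; case/andP: kappa01.
set A := area_const h K (2 * K') kappa.
have A0 : 0 <= A.
  rewrite /A /area_const mulr_ge0 ?chaining_const_ge0 ?mulr_gt0//.
  by rewrite addr_ge0 ?sqr_ge0// addr_ge0 ?sqr_ge0// divr_ge0 ?(ltW k1)// mulr_ge0.
exists (d%:R * (d%:R * (A * T^-1 `^ (2 * h)))).
  by do 2 rewrite mulr_ge0//; rewrite (mulr_ge0 A0)// powR_ge0.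
move=> m u v u0 uv vT; apply: (le_trans (euclid_norm_le_sum _)).
set B := A * T^-1 `^ (2 * h).
have -> : d%:R * (d%:R * B) * (v - u) `^ (2 * h) =
    \sum_(i < d) \sum_(j < d) (B * (v - u) `^ (2 * h)).
  rewrite (eq_bigr (fun=> d%:R * (B * (v - u) `^ (2 * h)))) => [|i _].
    by rewrite sumr_const card_ord -[RHS]mulr_natl !mulrA.
  by rewrite sumr_const card_ord -[LHS]mulr_natl.
apply: ler_sum => i _; apply: ler_sum => j _.
apply: (le_trans (iterated_integral2_dyadic_le m x i j u0 uv vT)).
have [a1 a2 a3] := tau_range m u0 uv vT.
have K2 : 0 <= 2 * K' by rewrite mulr_ge0.
(* On the diagonal the antisymmetric difference vanishes; off it, the two areas are bounded
   separately, whence 2 K'. *)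
have dA n t l : (l < 2 ^ n)%N ->
  `|dyadic_area T (fun s => x s 0 i) (fun s => x s 0 j) n t l -
    dyadic_area T (fun s => x s 0 j) (fun s => x s 0 i) n t l| <=
  2 * K' * (((2 `^ (- h)) ^+ 2) ^+ n * kappa ^+ t).
  move=> ln; have [->|ij] := eqVneq i j.
    rewrite subrr normr0 mulr_ge0// mulr_ge0 ?exprn_ge0 ?powR_ge0//.
    by case/andP: kappa01.
  apply: (le_trans (ler_normB _ _)); rewrite -mulrA mulr_natl mulr2n.
  by rewrite lerD// x_area// eq_sym.
apply: (le_trans (interp_area_bound h01 K0 K2 kappa01 (x_inc i) (x_inc j) dA a1 a2 a3)).
rewrite -/A (_ : tau m v - tau m u = (v - u) / T * 2 ^+ m); last by rewrite /tau; ring.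
have vu0 : 0 <= v - u by rewrite subr_ge0.
rewrite (_ : (2 `^ (- h)) ^+ 2 = 2 `^ (- (2 * h))); last first.
  by have := sqr_powR2N h 1; rewrite !expr1.
rewrite unscale// powRM// ?invr_ge0 ?(ltW T_gt0)// /B.
by rewrite -(mulrA A) (mulrC (T^-1 `^ _)).
Qed.

End dyadic_paths.

(** As hp >= 1, (v - u)^(hp) <= T^(hp-1) (v - u), and the lengths add up to T. *)
Lemma p_variation_le (R : realType) (T h p C : R) (D : seq R) (F : R -> R -> R) :
  0 < T -> 0 <= C -> 0 <= p -> 1 <= h * p -> itv_partition 0 T D ->
  (forall u v, 0 <= u -> u < v -> v <= T -> 0 <= F u v <= C * (v - u) `^ h) ->
  partition_sum 0 D (fun u v => F u v `^ p) <= C `^ p * T `^ (h * p).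
Proof.
move=> T0 C0 p0 hp pD HF.
have -> : C `^ p * T `^ (h * p) = C `^ p * T `^ (h * p - 1) * (T - 0).
  by rewrite subr0 -mulrA (mulrC _ T) mulr_powRB1 ?(ltW T0) ?(lt_le_trans ltr01 hp).
apply: partition_sum_le => // u v u0 uv vT.
have /andP[F0 FC] := HF u v u0 uv vT.
have vu : 0 <= v - u by rewrite subr_ge0 ltW.
apply: (@le_trans _ _ ((C * (v - u) `^ h) `^ p)).
  by rewrite ge0_ler_powR ?nnegrE ?mulr_ge0 ?powR_ge0.
rewrite powRM ?powR_ge0// -powRrM -mulrA ler_wpM2l ?powR_ge0//.
rewrite -(mulr_powRB1 vu (lt_le_trans ltr01 hp)) mulrC ler_wpM2r//.
rewrite ge0_ler_powR ?nnegrE ?subr_ge0 ?(ltW T0) ?(ltW uv)//.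
by rewrite (le_trans _ vT)// gerBl.
Qed.

(** * Mixed processes *)

Lemma ae_forall_countable (R : realType) d (T : measurableType d)
    (mu : {measure set T -> \bar R}) (I : countType) (Q : I -> T -> Prop) :
  (forall i, {ae mu, forall w, Q i w}) -> {ae mu, forall w, forall i, Q i w}.
Proof.
move=> HQ; have : {ae mu, forall w, forall n i, pickle i = n -> Q i w}.
  apply: ae_foralln => n; have [[i iE]|ni] := pselect (exists i : I, pickle i = n).
    apply: filterS (HQ i) => w Qw j jE.
    by have -> : j = i by apply: (pcan_inj (@pickleK I)); rewrite jE iE.
  by apply: aeW => w i iE; case: ni; exists i.
by apply: filterS => w Qw i; exact: Qw.
Qed.

Lemma ae_common_bound (R : realType) d (T : measurableType d)
    (mu : {measure set T -> \bar R}) (I : finType) (Q : I -> T -> R -> Prop) :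
  (forall i w K K', K <= K' -> Q i w K -> Q i w K') ->
  (forall i, {ae mu, forall w, exists2 K, 0 <= K & Q i w K}) ->
  {ae mu, forall w, exists2 K, 0 <= K & forall i, Q i w K}.
Proof.
move=> mono /ae_forall_countable; apply: filterS => w HQ.
have /choice[K HK] : forall i, exists K, 0 <= K /\ Q i w K.
  by move=> i; have [K K0 QK] := HQ i; exists K.
have K0 i : 0 <= K i by case: (HK i).
exists (\sum_i K i) => [|i]; first exact: sumr_ge0.
by apply: mono (HK i).2; rewrite (bigD1 i)//= lerDl sumr_ge0.
Qed.

Lemma mutually_independent2 (R : realType) d (Omega : measurableType d)
    (P : probability Omega R) (J : finType) (F : J -> set (set Omega)) i j A B :
  mutually_independent P F -> i != j -> F i A -> F j B ->
  P (A `&` B) = (P A * P B)%E.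
Proof.
move=> indF ij FA FB.
have ji : (j == i) = false by rewrite eq_sym; apply/negbTE.
have := indF [set i; j]%SET (fun k => if k == i then A else B).
have -> : \bigcap_(k in [set` [set i; j]%SET]) (if k == i then A else B) = A `&` B.
  apply/seteqP; split => w.
    move=> H; split; first by have := H i; rewrite /= !inE eqxx/=; apply.
    by have := H j; rewrite /= !inE eqxx orbT ji; apply.
  move=> [Aw Bw] k /=; rewrite !inE => /orP[]/eqP ->; first by rewrite eqxx.
  by rewrite ji.
move=> -> => [|k]; last first.
  by rewrite !inE => /orP[]/eqP ->; rewrite ?eqxx// ji.
by rewrite big_setU1/= ?inE ?(negbTE ij)// big_set1 eqxx ji.
Qed.

Section mixed_process_bounds.
Context {R : realType} d (Omega : measurableType d) (P : probability Omega R).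
Variables (N dim : nat) (a : 'rV[R]_N) (T : R) (B : 'I_N -> 'I_dim -> R -> {RV P >-> R}).

Lemma mixed_process_increment w i r k :
  dyadic_increment T (fun t => mixed_process a B t w 0 i) r k =
  \sum_l a 0 l * dyadic_increment T (fun t => B l i t w) r k.
Proof.
rewrite /dyadic_increment /mixed_process !mxE -sumrB.
by apply: eq_bigr => l _; rewrite mulrBr.
Qed.

Lemma mixed_process_area w i j n t k :
  dyadic_area T (fun t => mixed_process a B t w 0 i)
    (fun t => mixed_process a B t w 0 j) n t k =
  \sum_l \sum_l' (a 0 l * a 0 l') *
    dyadic_area T (fun t => B l i t w) (fun t => B l' j t w) n t k.
Proof.
rewrite /dyadic_area.
under eq_bigr do rewrite !mixed_process_increment mulr_suml.
rewrite exchange_big/=; apply: eq_bigr => l _.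
under eq_bigr do rewrite mulr_sumr.
rewrite exchange_big/=; apply: eq_bigr => l' _.
by rewrite mulr_sumr; apply: eq_bigr => q _; rewrite mulrACA.
Qed.

Lemma mixed_process_increment_le w i r k (K : R) :
  (forall l, `|dyadic_increment T (fun t => B l i t w) r k| <= K) ->
  `|dyadic_increment T (fun t => mixed_process a B t w 0 i) r k| <=
    (\sum_l `|a 0 l|) * K.
Proof.
move=> HK; rewrite mixed_process_increment mulr_suml.
apply: (le_trans (ler_norm_sum _ _ _)); apply: ler_sum => l _.
by rewrite normrM ler_wpM2l.
Qed.

Lemma mixed_process_area_le w i j n t k (K : R) :
  (forall l l', `|dyadic_area T (fun t => B l i t w) (fun t => B l' j t w) n t k| <= K) ->
  `|dyadic_area T (fun t => mixed_process a B t w 0 i)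
    (fun t => mixed_process a B t w 0 j) n t k| <= (\sum_l `|a 0 l|) ^+ 2 * K.
Proof.
move=> HK; rewrite mixed_process_area expr2 -mulrA mulr_suml.
apply: (le_trans (ler_norm_sum _ _ _)); apply: ler_sum => l _.
rewrite mulr_suml mulr_sumr.
apply: (le_trans (ler_norm_sum _ _ _)); apply: ler_sum => l' _.
by rewrite !normrM -mulrA !ler_wpM2l.
Qed.

End mixed_process_bounds.

(* Above Hurst index 1/2 Hoelder continuity alone controls the area. *)
Lemma dyadic_area_le (R : realType) (T h K : R) (x y : R -> R) n t l :
  0 <= h -> 0 <= K ->
  (forall r k, (k < 2 ^ r)%N -> `|dyadic_increment T x r k| <= K * (2 `^ (- h)) ^+ r) ->
  (forall r k, (k < 2 ^ r)%N -> `|dyadic_increment T y r k| <= K * (2 `^ (- h)) ^+ r) ->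
  (l < 2 ^ n)%N ->
  `|dyadic_area T x y n t l| <=
    K ^+ 2 * (((2 `^ (- h)) ^+ 2) ^+ n * (2 * (2 `^ (- h)) ^+ 2) ^+ t).
Proof.
move=> h0 K0 Hx Hy ln; set b := 2 `^ (- h).
have b0 : 0 <= b by exact: powR_ge0.
have b1 : b <= 1 by rewrite -[leRHS](powRr0 2) ler_powR ?ler1n// oppr_le0.
apply: (le_trans (ler_norm_sum _ _ _)).
apply: (@le_trans _ _ (\sum_(q < 2 ^ t) K ^+ 2 * (b ^+ 2) ^+ (n + t))); last first.
  rewrite sumr_const card_ord -[leLHS]mulr_natl natrX (exprMn t 2) (exprD (b ^+ 2)).
  by rewrite le_eqVlt; apply/orP; left; apply/eqP; move: (2 ^+ t) => z; ring.
apply: ler_sum => q _.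
have ix := dyadic_area_index_lt ln (ltn_ord q).
rewrite normrM.
apply: (le_trans (ler_pM (normr_ge0 _) (normr_ge0 _) (Hx _ _ (ltnW ix)) (Hy _ _ ix))).
rewrite -/b mulrACA -expr2 ler_wpM2l ?sqr_ge0//.
rewrite (_ : (b ^+ 2) ^+ (n + t) = b ^+ (n + t) * b ^+ (n + t)); last by rewrite expr2 exprMn.
have bS : b ^+ (n + t).+1 <= b ^+ (n + t) by rewrite exprS ler_piMl ?exprn_ge0.
by apply: ler_pM => //; exact: exprn_ge0.
Qed.

Lemma min_hurst_le (R : realType) (N : nat) (H : 'rV[R]_N) k : min_hurst H <= H 0 k.
Proof. by rewrite /min_hurst; apply: bigmin_le_cond. Qed.

(** Applied with c = sqrt 2 = 2^(2 * 1/4) and c = 2 = 2^(2 * 1/2), it produces the thresholds 1/4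
    and 1/2. *)
Lemma powR2N_sqr_lt (R : realType) (c h : R) : 0 < c -> c <= 2 `^ (2 * h) -> 0 < h ->
  forall h', h < h' -> c * (2 `^ (- h')) ^+ 2 < 1.
Proof.
move=> c0 ch h0 h' hh'.
have -> : (2 `^ (- h')) ^+ 2 = (2 `^ (2 * h'))^-1.
  by rewrite -powRN; have := sqr_powR2N h' 1; rewrite !expr1.
rewrite ltr_pdivrMr ?powR_gt0// mul1r; apply: (le_lt_trans ch).
have := powR2_gt1 (_ : 0 < 2 * h' - 2 * h); rewrite subr_gt0 ltr_pM2l// => /(_ hh') h1.
rewrite (_ : 2 * h' = 2 * h + (2 * h' - 2 * h)); last by ring.
by rewrite powRD ?pnatr_eq0 ?implybT// ltr_pMr ?powR_gt0.
Qed.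

Theorem proposition3p4 (R : realType) (disp : measure_display)
    (Omega : measurableType disp) (P : probability Omega R)
    (N d : nat) (H a : 'rV[R]_N) (T : R)
    (B : 'I_N -> 'I_d -> R -> {RV P >-> R}) (p : R)
    (N_ge1 : (1 <= N)%N) (T_gt0 : 0 < T)
    (H01 : forall k, 0 < H 0 k < 1) (a_neq0 : a != 0)
    (B_fbm : forall k, is_fbm_vec `[0, T] (H 0 k) (B k))
    (B_indep : independent_processes `[0, T] B)
    (H_gt : 1 / 4 < min_hurst H) (p_gt : 1 / min_hurst H < p) :
  {ae P, forall w, exists2 C : R, 0 < C &
    forall (m : nat) (D : seq R), (1 <= m)%N -> itv_partition 0 T D ->
      let Mm := dyadic_path T m (fun t => mixed_process a B t w) in
      partition_sum 0 D (fun u v => euclid_norm (Mm v - Mm u) `^ p) <= C /\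
      partition_sum 0 D
        (fun u v => euclid_norm (iterated_integral2 Mm u v) `^ (p / 2)) <= C}.
Proof.
set h0 := min_hurst H in H_gt p_gt.
have h0_gt0 : 0 < h0 by apply: lt_trans H_gt.
have p_gt0 : 0 < p by apply: lt_trans p_gt; rewrite divr_gt0.
have h0_lt1 : h0 < 1.
  by apply: le_lt_trans (min_hurst_le H (Ordinal N_ge1)) _; case/andP: (H01 (Ordinal N_ge1)).
have pV_lt : p^-1 < h0.
  by rewrite -[h0]invrK ltf_pV2 ?posrE ?invr_gt0// -div1r.
(* For k = k' this is independence of the components of one vector; otherwise each component's
   sigma-algebra lies in that of its vector process. *)
have indep2 k k' i j : i != j -> forall E F,
    generated_sigma `[0, T] (B k i) E -> generated_sigma `[0, T] (B k' j) F ->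
    P (E `&` F) = (P E * P F)%E.
  move=> ij E F; have [->|kk'] := eqVneq k k'.
    exact: (mutually_independent2 (B_fbm k').2 ij).
  have sub l i' : generated_sigma `[0, T] (B l i') `<=`
      generated_sigma [set it : 'I_d * R | `[0, T]%classic it.2] (fun it => B l it.1 it.2).
    apply: sub_smallest2r; first exact: smallest_sigma_algebra.
    by move=> _ [t [It [A [mA ->]]]]; exists (i', t); split => //; exists A.
  by move=> /sub EE /sub FF; exact: (mutually_independent2 B_indep kk' EE FF).
have inc_ae h : h < h0 -> {ae P, forall w, exists2 K : R, 0 <= K &
    forall (ki : 'I_N * 'I_d) r k, (k < 2 ^ r)%N ->
    `|dyadic_increment T (fun t => B ki.1 ki.2 t w) r k| <= K * (2 `^ (- h)) ^+ r}.
  move=> hh0; apply: ae_common_bound => [ki w K K' KK' HK r k kr|[k i]].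
    by apply: le_trans (HK r k kr) _; rewrite ler_wpM2r// exprn_ge0// powR_ge0.
  apply: (dyadic_increment_ae T_gt0 (H01 k)); last exact: (B_fbm k).1.
  exact: lt_le_trans (min_hurst_le H k).
have [h [kappa [hh0 ph h_gt0 k01 area_ae]]] : exists h kappa : R,
    [/\ h < h0, p^-1 < h, 0 < h, 0 <= kappa < 1 &
    {ae P, forall w, exists2 K : R, 0 <= K &
      forall q : ('I_N * 'I_d) * ('I_N * 'I_d), q.1.2 != q.2.2 ->
      forall n t l, (l < 2 ^ n)%N ->
      `|dyadic_area T (fun t => B q.1.1 q.1.2 t w) (fun t => B q.2.1 q.2.2 t w) n t l| <=
      K * (((2 `^ (- h)) ^+ 2) ^+ n * kappa ^+ t)}].
  have [h0_le|h0_gt] := leP h0 (1 / 2).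
    (* Above 1/4, [h] makes the ratio [kappa] less than 1; above 1/p it suits the variation
       exponent; below [h0] it leaves the loss of exponent needed in [dyadic_area_ae]. *)
    pose h := (Num.max (1 / 4) p^-1 + h0) / 2.
    have m_lt : Num.max (1 / 4) p^-1 < h0 by rewrite gt_max H_gt pV_lt.
    have m4 : 1 / 4 <= Num.max (1 / 4) p^-1 by rewrite le_max lexx.
    have mp : p^-1 <= Num.max (1 / 4) p^-1 by rewrite le_max lexx orbT.
    have hh0 : h < h0 by rewrite /h; lra.
    have h4 : 1 / 4 < h by rewrite /h; lra.
    exists h, (Num.sqrt 2 * (2 `^ (- h)) ^+ 2); split => //.
    - by rewrite /h; lra.
    - by apply: lt_trans h4; rewrite divr_gt0.
    - rewrite mulr_ge0 ?sqrtr_ge0 ?sqr_ge0//=.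
      have s4 : Num.sqrt 2 <= 2 `^ (2 * (1 / 4)) :> R.
        by rewrite -powR12_sqrt// ler_powR ?ler1n//; lra.
      by apply: (powR2N_sqr_lt _ s4 _ h4); rewrite ?sqrtr_gt0 ?divr_gt0.
    apply: ae_common_bound => [q w K K' KK' HK ij n t l ln|[[k i] [k' j]]].
      by apply: le_trans (HK ij n t l ln) _; rewrite ler_wpM2r.
    have [->|ij] := eqVneq i j.
      by apply: aeW => w; exists 0 => // /=; rewrite eqxx.
    have h0k : 0 < h0 <= H 0 k by rewrite h0_gt0 min_hurst_le.
    have := dyadic_area_ae T_gt0 (H01 k) (H01 k') (h := h0) (h' := h)
      h0k (min_hurst_le H k') h0_le hh0 ((B_fbm k).1 i) ((B_fbm k').1 j) (indep2 k k' i j ij).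
    apply: filterS.
    by move=> w [K K0 HK]; exists K.
  (* Now h > 1/2, so the Hoelder bound sums with the ratio 2 * 2^(-2h) < 1. *)
  pose h := (Num.max (1 / 2) p^-1 + h0) / 2.
  have m_lt : Num.max (1 / 2) p^-1 < h0 by rewrite gt_max h0_gt pV_lt.
  have m2 : 1 / 2 <= Num.max (1 / 2) p^-1 by rewrite le_max lexx.
  have mp : p^-1 <= Num.max (1 / 2) p^-1 by rewrite le_max lexx orbT.
  have hh0 : h < h0 by rewrite /h; lra.
  have h2 : 1 / 2 < h by rewrite /h; lra.
  have h_gt0 : 0 < h by apply: lt_trans h2; rewrite divr_gt0.
  exists h, (2 * (2 `^ (- h)) ^+ 2); split => //.
  - by rewrite /h; lra.
  - rewrite mulr_ge0 ?sqr_ge0//=; apply: (@powR2N_sqr_lt _ _ (1 / 2)) => //.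
    by rewrite (_ : 2 * (1 / 2) = 1) ?powRr1//; field.
  apply: filterS (inc_ae h hh0) => w [K K0 HK]; exists (K ^+ 2); first exact: sqr_ge0.
  move=> q _ n t l ln.
  exact: (dyadic_area_le t (ltW h_gt0) K0 (HK q.1) (HK q.2) ln).
have hp : 1 <= h * p by rewrite -ler_pdivrMr// div1r ltW.
have h01 : 0 < h <= 1 by rewrite h_gt0 ltW// (lt_trans hh0).
apply: filterS2 (inc_ae h hh0) area_ae => w [K K0 HK] [K' K'0 HK'].
set S := \sum_l `|a 0 l|; have S0 : 0 <= S by exact: sumr_ge0.
pose x t := mixed_process a B t w.
have x_inc i r k : (k < 2 ^ r)%N ->
    `|dyadic_increment T (fun t => x t 0 i) r k| <= (S * K) * (2 `^ (- h)) ^+ r.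
  by move=> kr; rewrite -mulrA; apply: mixed_process_increment_le => l; exact: (HK (l, i)).
have x_area i j : i != j -> forall n t l, (l < 2 ^ n)%N ->
    `|dyadic_area T (fun t => x t 0 i) (fun t => x t 0 j) n t l| <=
    (S ^+ 2 * K') * (((2 `^ (- h)) ^+ 2) ^+ n * kappa ^+ t).
  move=> ij n t l ln; rewrite -mulrA; apply: mixed_process_area_le => k k'.
  exact: (HK' ((k, i), (k', j))).
have SK0 : 0 <= S * K by exact: mulr_ge0.
have SK'0 : 0 <= S ^+ 2 * K' by rewrite mulr_ge0// sqr_ge0.
have [C1 C10 HC1] := dyadic_path_holder T_gt0 h01 SK0 x_inc.
have [C2 C20 HC2] := dyadic_path_area_holder T_gt0 h01 SK0 SK'0 k01 x_inc x_area.
set E1 := C1 `^ p * T `^ (h * p).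
set E2 := C2 `^ (p / 2) * T `^ (2 * h * (p / 2)).
have E10 : 0 <= E1 by rewrite mulr_ge0 ?powR_ge0.
have E20 : 0 <= E2 by rewrite mulr_ge0 ?powR_ge0.
have E0 : 0 < 1 + E1 + E2 by lra.
exists (1 + E1 + E2) => // m D _ pD.
pose Mm := dyadic_path T m x.
have euclid_ge0 n1 n2 (A : 'M[R]_(n1, n2)) : 0 <= euclid_norm A by exact: sqrtr_ge0.
split.
  apply: (@le_trans _ _ E1); last by lra.
  apply: (p_variation_le (F := fun u v => euclid_norm (Mm v - Mm u))) => //.
    exact: ltW.
  by move=> u v u0 uv vT; rewrite euclid_ge0 HC1// ltW.
apply: (@le_trans _ _ E2); last by lra.
apply: (p_variation_le (F := fun u v => euclid_norm (iterated_integral2 Mm u v))) => //.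
- by rewrite divr_ge0// ltW.
- by rewrite (_ : 2 * h * (p / 2) = h * p)//; field.
- by move=> u v u0 uv vT; rewrite euclid_ge0 HC2// ltW.
Qed.
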